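(* Let $\delta\in(0,1/2)$, $\varepsilon=\sqrt{2\delta}$, and let $X=D_\varepsilon$ be the real three-dimensional normed space $\mathbb{R}^3$ whose closed unit ball is the absolute convex hull of the points $A_1,\dots,A_{11}$ (that is, the convex hull of the 22 points $\pm A_1,\dots,\pm A_{11}$), where $$A_1=(0,0,\tfrac34),$$ $$A_2=(1-\varepsilon,1,\tfrac{\varepsilon}{2}),\ A_3=(1-\varepsilon,-1,\tfrac{\varepsilon}{2}),\ A_4=(\varepsilon-1,1,\tfrac{\varepsilon}{2}),\ A_5=(\varepsilon-1,-1,\tfrac{\varepsilon}{2}),$$ $$A_6=(1,1-\varepsilon,\tfrac{\varepsilon}{2}),\ A_7=(-1,1-\varepsilon,\tfrac{\varepsilon}{2}),\ A_8=(1,\varepsilon-1,\tfrac{\varepsilon}{2}),\ A_9=(-1,\varepsilon-1,\tfrac{\varepsilon}{2}),$$ $$A_{10}=(1,1,0),\ A_{11}=(1,-1,0).$$ Then $\Phi_X(\delta)<\sqrt{2\delta}$.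
   Context: For a (real or complex) Banach space $X\neq\{0\}$, $B_X$ denotes its closed unit ball, $X^*$ its topological dual, and $\Pi(X):=\{(x,x^* )\in X\times X^* : \|x\|=\|x^*\|=x^*(x)=1\}$. The Bishop-Phelps-Bollobás modulus $\Phi_X:(0,2)\to[0,\infty)$ is defined as follows: $\Phi_X(\delta)$ is the infimum of those $\varepsilon'>0$ such that for every $(x,x^* )\in B_X\times B_{X^*}$ with $\operatorname{Re} x^*(x)>1-\delta$ there is $(y,y^* )\in\Pi(X)$ with $\|x-y\|<\varepsilon'$ and $\|x^*-y^*\|<\varepsilon'$. *)

(* Defs.v *)
From HB Require Import structures.
From mathcomp Require Import all_boot all_order all_algebra.
From mathcomp Require Import ring lra.
From mathcomp Require Import all_classical all_reals all_analysis.

Set Implicit Arguments.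
Unset Strict Implicit.
Unset Printing Implicit Defensive.

Import Order.TTheory GRing.Theory Num.Theory.
Import numFieldNormedType.Exports.

Local Open Scope classical_set_scope.
Local Open Scope ring_scope.

Section bishop_phelps_bollobas.
Context {R : realType} (X : normedModType R).

(* Meaningful for continuous linear f only: the set is then bounded. *)
Definition dual_norm (f : X -> R) : R :=
  sup [set `|f x| | x in [set x : X | `|x| <= 1]].

(* The elements of the topological dual are the [f : {linear X -> R^o}] such
   that [continuous f]. *)
Definition norming_pairs : set (X * {linear X -> R^o}) :=
  [set p : X * {linear X -> R^o} |
    [/\ continuous p.2, `|p.1| = 1, dual_norm p.2 = 1 & p.2 p.1 = 1]].

(* The infimum is taken in the extended reals, where [ereal_inf set0 = +oo];
   the real-valued [inf] would return the junk value 0 on [set0]. *)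
Definition bpb_modulus (delta : R) : \bar R :=
  ereal_inf [set e%:E | e in [set e : R | 0 < e /\
    forall (x : X) (f : {linear X -> R^o}), continuous f ->
      `|x| <= 1 -> dual_norm f <= 1 -> 1 - delta < f x ->
      exists y g, [/\ norming_pairs (y, g),
        `|x - y| < e & dual_norm (f \- g) < e]]].

End bishop_phelps_bollobas.

Section convex_hull.
Context {R : realType} (V : lmodType R).

Definition convex_hull (S : set V) : set V := smallest (@convex_set R V) S.

Definition abs_convex_hull (S : set V) : set V :=
  convex_hull (S `|` [set - x | x in S]).

Definition minkowski_functional (B : set V) (v : V) : R :=
  inf [set t : R | 0 < t /\ B (t^-1 *: v)].

End convex_hull.

Section abs_convex_hull_lemmas.
Context {R : realType} {V : lmodType R}.
Implicit Types (S : set V) (x y : V) (a b : R).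

Lemma convex_setP (A : set V) : @convex_set R V A <->
  (forall x y a b, 0 <= a -> 0 <= b -> a + b = 1 -> A x -> A y ->
    A (a *: x + b *: y)).
Proof.
split=> [cA x y a b a0 b0 ab Ax Ay|cA x y k].
  have a1 : a <= 1 by rewrite -ab lerDl.
  have := cA x y (Itv01 a0 a1); rewrite !inE => /(_ Ax Ay).
  by rewrite /conv /= /unstable.onem -ab addrAC subrr add0r.
rewrite !inE => Ax Ay; apply: cA; rewrite // ?ge0//.
  by rewrite /unstable.onem subr_ge0; exact: le1.
by rewrite /unstable.onem addrC subrK.
Qed.

Lemma abs_convex_hull_convex S : @convex_set R V (abs_convex_hull S).
Proof.
apply/convex_setP => x y a b a0 b0 ab hx hy A [cA SA].
move/convex_setP : (cA); apply => //; [exact: hx|exact: hy].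
Qed.

Lemma sub_abs_convex_hull S : S `<=` abs_convex_hull S.
Proof. by move=> x Sx; apply: sub_gen_smallest; left. Qed.

Lemma abs_convex_hullN S x : abs_convex_hull S x -> abs_convex_hull S (- x).
Proof.
move=> hx; apply: (hx [set y | abs_convex_hull S (- y)]); split.
  apply/convex_setP => y z a b a0 b0 ab /= hy hz.
  rewrite opprD -!scalerN.
  by move/convex_setP : (@abs_convex_hull_convex S); apply.
move=> y [Sy|[z Sz <-]] /=.
  by apply: sub_gen_smallest; right; exists y.
by rewrite opprK; exact: sub_abs_convex_hull.
Qed.

Lemma abs_convex_hull0 S : S !=set0 -> abs_convex_hull S 0.
Proof.
move=> [x Sx]; have hx := sub_abs_convex_hull Sx.
have -> : 0 = 2^-1 *: x + 2^-1 *: (- x) :> V by rewrite scalerN subrr.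
move/convex_setP : (@abs_convex_hull_convex S); apply => //.
- by lra.
- exact: abs_convex_hullN.
Qed.

Lemma abs_convex_hull_seq (s : seq V) : s != [::] ->
  abs_convex_hull [set` s] =
  [set \sum_(i < size s) l 0 i *: s`_i |
     l in [set l : 'rV[R]_(size s) | \sum_i `|l 0 i| <= 1]].
Proof.
move=> s0; have hS : [set` s] !=set0.
  by case: s s0 => // x s _; exists x; rewrite /= mem_head.
apply/seteqP; split.
  apply: smallest_sub.
    apply/convex_setP => x y a b a0 b0 ab [l /= l1 <-] [m /= m1 <-].
    exists (a *: l + b *: m); last first.
      rewrite !scaler_sumr -big_split /=; apply: eq_bigr => i _.
      by rewrite !mxE scalerDl !scalerA.
    apply: (@le_trans _ _ (a * \sum_i `|l 0 i| + b * \sum_i `|m 0 i|)).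
      rewrite !mulr_sumr -big_split /=; apply: ler_sum => i _.
      rewrite !mxE (le_trans (ler_normD _ _))// !normrM.
      by rewrite (ger0_norm a0) (ger0_norm b0).
    by rewrite -ab lerD// ler_piMr.
  have key (x : V) (c : R) : `|c| <= 1 -> x \in s -> exists2 l : 'rV[R]_(size s),
      \sum_i `|l 0 i| <= 1 & \sum_(i < size s) l 0 i *: s`_i = c *: x.
    move=> c1 xs; have xs' : (index x s < size s)%N by rewrite index_mem.
    pose k := Ordinal xs'.
    exists (\row_i (if i == k then c else 0)).
      rewrite (bigD1 k)//= mxE eqxx big1 ?addr0// => i /negbTE ik.
      by rewrite mxE ik normr0.
    rewrite (bigD1 k)//= mxE eqxx big1 ?addr0 ?nth_index// => i /negbTE ik.
    by rewrite mxE ik scale0r.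
  move=> x [xs|[y ys <-]].
    by have [|l l1 lx] := key x 1 _ xs; [rewrite normr1|exists l; rewrite // lx scale1r].
  have [|l l1 lx] := key y (-1) _ ys; first by rewrite normrN1.
  by exists l; rewrite // lx scaleN1r.
move=> _ [l /= l1 <-].
set H := abs_convex_hull _.
have cH := (convex_setP H).1 (@abs_convex_hull_convex [set` s]).
have H0 : H 0 by exact: abs_convex_hull0.
have [_ [x Hx ->]] : 0 <= \sum_i `|l 0 i| /\
    exists2 x, H x & \sum_(i < size s) l 0 i *: s`_i = (\sum_i `|l 0 i|) *: x.
  apply: (big_ind2 (fun u c => 0 <= c /\ exists2 x, H x & u = c *: x)).
  - by split => //; exists 0; rewrite ?scaler0.
  - move=> u c v d [c0 [x Hx ->]] [d0 [y Hy ->]]; split; first exact: addr_ge0.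
    have [cd0|cd0] := eqVneq (c + d) 0.
      have c0' : c = 0 by lra.
      have d0' : d = 0 by lra.
      by exists 0; rewrite // c0' d0' !scale0r addr0 scaler0.
    have cdp : 0 <= c + d by exact: addr_ge0.
    exists ((c / (c + d)) *: x + (d / (c + d)) *: y).
      by apply: cH; rewrite ?divr_ge0// -mulrDl divff.
    by rewrite scalerDr !scalerA ![(c + d) * _]mulrC !divfK.
  - move=> i _; split=> //.
    have Hi : H s`_i by apply: sub_abs_convex_hull; rewrite /= mem_nth.
    have [l0|l0] := leP 0 (l 0 i).
      by exists s`_i; rewrite // ger0_norm.
    exists (- s`_i); first exact: abs_convex_hullN.
    by rewrite ltr0_norm// scalerN scaleNr opprK.
have S0 : 0 <= \sum_i `|l 0 i| by apply: sumr_ge0.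
rewrite -[_ *: x]addr0 -[X in _ + X](scaler0 _ (1 - \sum_i `|l 0 i|)).
by apply: cH => //; [rewrite subr_ge0|rewrite addrC subrK].
Qed.

End abs_convex_hull_lemmas.

Lemma abs_convex_hull_compact (R : realType) m (s : seq 'rV[R]_m) :
  s != [::] -> compact (abs_convex_hull [set` s]).
Proof.
move=> s0; rewrite abs_convex_hull_seq//; apply: continuous_compact.
  apply: continuous_subspaceT.
  apply: continuous_big => [|i _ l]; first exact: add_continuous.
  by apply: cvgZr_tmp; [exact: nbhs_filter|exact: coord_continuous].
apply: bounded_closed_compact.
  exists 1; split; first exact: num_real.
  move=> M M1 l /= l1; rewrite (le_trans _ (ltW M1))//.
  rewrite /Num.norm/= mx_normrE; apply/bigmax_leP; split=> //= -[i j] _ /=.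
  rewrite ord1 (le_trans _ l1)// (bigD1 j)//= lerDl.
  by apply: sumr_ge0.
rewrite [X in closed X](_ : _ =
  (fun l : 'rV[R]_(size s) => \sum_i `|l 0 i|) @^-1` [set x | x <= 1])//.
apply: closed_comp; last exact: closed_le.
move=> + _; apply: continuous_big => [|i _ l]; first exact: add_continuous.
by apply: cvg_norm; [exact: nbhs_filter|exact: coord_continuous].
Qed.

Section minkowski_functional_lemmas.
Context {R : realType} {V : lmodType R} (B : set V).
Hypothesis cB : @convex_set R V B.
Hypothesis BN : forall x, B x -> B (- x).
Hypothesis Babs : forall x, exists2 t : R, 0 < t & B (t^-1 *: x).
Local Notation p := (minkowski_functional B).

Let B0 : B 0.
Proof. by have [t _] := Babs 0; rewrite scaler0. Qed.

Let has_inf_p x : has_inf [set t : R | 0 < t /\ B (t^-1 *: x)].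
Proof.
split; first by have [t t0 Bt] := Babs x; exists t.
by exists 0 => t [/ltW].
Qed.

Lemma minkowski_functional_ge0 x : 0 <= p x.
Proof. by apply: lb_le_inf; [exact: (has_inf_p x).1|move=> t [/ltW]]. Qed.

Lemma minkowski_functional_le x t : 0 < t -> B (t^-1 *: x) -> p x <= t.
Proof. by move=> t0 Bt; apply: ge_inf => //; exact: (has_inf_p x).2. Qed.

Lemma minkowski_functional_lt x t : p x < t -> B (t^-1 *: x).
Proof.
move=> /(inf_lt (has_inf_p x).1) [s [s0 Bs] st].
have t0 : 0 < t by exact: lt_trans st.
have -> : t^-1 *: x = (s / t) *: (s^-1 *: x) + (1 - s / t) *: 0.
  by rewrite scaler0 addr0 scalerA mulrAC divff ?mul1r// gt_eqF.
move/convex_setP : cB; apply => //.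
- by rewrite divr_ge0// ltW.
- by rewrite subr_ge0 ler_pdivrMr// mul1r ltW.
- by rewrite addrC subrK.
Qed.

Lemma minkowski_functionalD x y : p (x + y) <= p x + p y.
Proof.
apply/ler_addgt0Pr => e e0.
set s := p x + e / 2; set t := p y + e / 2.
have s0 : 0 < s by rewrite ltr_wpDl ?divr_gt0// minkowski_functional_ge0.
have t0 : 0 < t by rewrite ltr_wpDl ?divr_gt0// minkowski_functional_ge0.
have Bs : B (s^-1 *: x) by apply: minkowski_functional_lt; rewrite ltrDl divr_gt0.
have Bt : B (t^-1 *: y) by apply: minkowski_functional_lt; rewrite ltrDl divr_gt0.
have -> : p x + p y + e = s + t by rewrite /s /t; lra.
apply: minkowski_functional_le; first exact: addr_gt0.
have st0 : 0 < s + t by exact: addr_gt0.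
have -> : (s + t)^-1 *: (x + y) =
    (s / (s + t)) *: (s^-1 *: x) + (t / (s + t)) *: (t^-1 *: y).
  rewrite scalerDr !scalerA ![_ / (s + t) / _]mulrAC.
  by rewrite !divff ?gt_eqF// !mul1r.
move/convex_setP : cB; apply => //.
- by rewrite divr_ge0// ltW.
- by rewrite divr_ge0// ltW.
- by rewrite -mulrDl divff// gt_eqF.
Qed.

Lemma minkowski_functionalZ (l : R) x : p (l *: x) = `|l| * p x.
Proof.
have le (k : R) y : k != 0 -> p (k *: y) <= `|k| * p y.
  move=> k0; have nk0 : 0 < `|k| by rewrite normr_gt0.
  rewrite -ler_pdivrMl//; apply/ler_addgt0Pr => e e0; rewrite ler_pdivrMl//.
  have pe : p y < p y + e by rewrite ltrDl.
  apply: minkowski_functional_le.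
    by rewrite mulr_gt0// (le_lt_trans _ pe)// minkowski_functional_ge0.
  have -> : (`|k| * (p y + e))^-1 *: (k *: y) =
      (`|k|^-1 * k) *: ((p y + e)^-1 *: y).
    by rewrite !scalerA invfM; congr (_ *: _); ring.
  have [kp|kn|k00] := ltgtP 0 k.
  - rewrite gtr0_norm// mulVf// scale1r; exact: minkowski_functional_lt.
  - rewrite ltr0_norm// invrN mulNr mulVf// scaleN1r.
    by apply: BN; exact: minkowski_functional_lt.
  - by rewrite -k00 eqxx in k0.
have [->|l0] := eqVneq l 0.
  rewrite scale0r normr0 mul0r; apply/eqP; rewrite eq_le minkowski_functional_ge0.
  rewrite andbT; apply/ler_addgt0Pr => e e0; rewrite add0r.
  by apply: minkowski_functional_le; rewrite ?scaler0.
apply/eqP; rewrite eq_le le//=.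
have := le l^-1 (l *: x); rewrite scalerA mulVf// scale1r invr_neq0// => /(_ isT).
by rewrite normfV -ler_pdivrMl ?invr_gt0 ?normr_gt0// invrK.
Qed.

End minkowski_functional_lemmas.

Section minkowski_functional_rV.
Context {R : realType} {m : nat} (B : set 'rV[R]_m).
Hypothesis cB : @convex_set R 'rV[R]_m B.
Hypothesis BN : forall x, B x -> B (- x).
Hypothesis Babs : forall x, exists2 t : R, 0 < t & B (t^-1 *: x).
Hypothesis Bcpt : compact B.
Local Notation p := (minkowski_functional B).

Lemma minkowski_functional_eq0 x : p x = 0 -> x = 0.
Proof.
move=> px0; have [M [_ BM]] := compact_bounded Bcpt.
pose N : R := Num.max (M + 1) 1.
have N0 : 0 < N by rewrite lt_max ltr01 orbT.
apply/eqP; rewrite -normr_eq0 eq_le normr_ge0 andbT.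
apply/ler_addgt0Pr => e e0; rewrite add0r.
have eN : 0 < e / N by rewrite divr_gt0.
have := @minkowski_functional_lt _ _ _ cB Babs x (e / N).
rewrite px0 => /(_ eN) /(BM N); rewrite lt_max ltrDl ltr01/= => /(_ isT).
by rewrite normrZ gtr0_norm ?invr_gt0// ler_pdivrMl// divfK// gt_eqF.
Qed.

Lemma minkowski_functional_unit_ball : [set x | p x <= 1] = B.
Proof.
apply/seteqP; split => x /=; last first.
  by move=> Bx; apply: minkowski_functional_le; rewrite ?invr1 ?scale1r.
move=> px1; have clB : closed B.
  by apply: compact_closed => //; exact: norm_hausdorff.
apply: clB => U /nbhs_ballP [r /= r0 rU].
pose t := 1 + r / (1 + `|x|) / 2.
have x0 : 0 < 1 + `|x| by rewrite ltr_wpDr.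
have d0 : 0 < r / (1 + `|x|) / 2 by rewrite !divr_gt0.
have t1 : 1 < t by rewrite ltrDl.
have t0 : 0 < t by exact: lt_trans t1.
exists (t^-1 *: x); split.
  apply: minkowski_functional_lt => //; exact: le_lt_trans t1.
apply: rU; rewrite -ball_normE /ball_ /=.
rewrite -[X in X - _]scale1r -scalerBl normrZ.
have -> : 1 - t^-1 = (r / (1 + `|x|) / 2) / t.
  have -> : r / (1 + `|x|) / 2 = t - 1 by rewrite /t addrAC subrr add0r.
  by rewrite mulrBl divff ?mul1r// gt_eqF.
rewrite gtr0_norm ?divr_gt0//.
have h : r / (1 + `|x|) / 2 / t <= r / (1 + `|x|) / 2.
  by rewrite ler_pdivrMr// ler_peMr// ltW.
apply: (le_lt_trans (ler_wpM2r (normr_ge0 _) h)).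
rewrite mulrAC ltr_pdivrMr// mulrAC ltr_pdivrMr// -mulrA ltr_pM2l//.
have := normr_ge0 x; lra.
Qed.

End minkowski_functional_rV.

Section D_space.
Context {R : realType}.
Implicit Types e : R.

Definition point3 (a b c : R) : 'rV[R]_3 := \row_(i < 3) [:: a; b; c]`_i.

Definition D_points e : seq 'rV[R]_3 :=
  [:: point3 0 0 (3 / 4);
      point3 (1 - e) 1 (e / 2);
      point3 (1 - e) (-1) (e / 2);
      point3 (e - 1) 1 (e / 2);
      point3 (e - 1) (-1) (e / 2);
      point3 1 (1 - e) (e / 2);
      point3 (-1) (1 - e) (e / 2);
      point3 1 (e - 1) (e / 2);
      point3 (-1) (e - 1) (e / 2);
      point3 1 1 0;
      point3 1 (-1) 0].

Definition D_ball e : set 'rV[R]_3 := abs_convex_hull [set` D_points e].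

Lemma D_ball_convex e : @convex_set R 'rV[R]_3 (D_ball e).
Proof. exact: abs_convex_hull_convex. Qed.

Lemma D_ballN e x : D_ball e x -> D_ball e (- x).
Proof. exact: abs_convex_hullN. Qed.

Lemma D_ball_compact e : compact (D_ball e).
Proof. exact: abs_convex_hull_compact. Qed.

(* (0,0,3/4), (1,1,0) and (1,-1,0) span the space for every value of [e]. *)
Lemma D_ball_absorbing e x : exists2 t : R, 0 < t & D_ball e (t^-1 *: x).
Proof.
pose a := x 0 0; pose b := x 0 1; pose c := x 0 2%:R.
pose t := 1 + `|a| + `|b| + 4 / 3 * `|c|.
have a0 := normr_ge0 a; have b0 := normr_ge0 b; have c0 := normr_ge0 c.
have t0 : 0 < t by rewrite /t; lra.
exists t => //; rewrite /D_ball abs_convex_hull_seq//.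
pose u := (a + b) / 2; pose v := (a - b) / 2; pose w := 4 / 3 * c.
pose l : 'rV[R]_(size (D_points e)) :=
  t^-1 *: \row_i [:: w; 0; 0; 0; 0; 0; 0; 0; 0; u; v]`_i.
exists l => /=.
  rewrite !big_ord_recl big_ord0 /= !mxE /= !mulr0 !normr0 !(normrM t^-1).
  rewrite (gtr0_norm (_ : 0 < t^-1)) ?invr_gt0//.
  rewrite !(add0r, addr0) -!mulrDr ler_pdivrMl// mulr1 /t.
  have ha := ler_norm a; have ha' := ler_norm (- a); rewrite normrN in ha'.
  have hb := ler_norm b; have hb' := ler_norm (- b); rewrite normrN in hb'.
  have hu : `|u| + `|v| <= `|a| + `|b|.
    by rewrite /u /v; case: (ler0P ((a + b) / 2)); case: (ler0P ((a - b) / 2)); lra.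
  have -> : `|w| = 4 / 3 * `|c| by rewrite normrM gtr0_norm//; lra.
  lra.
rewrite !big_ord_recl big_ord0 /= !mxE /= !mulr0 !scale0r !(add0r, addr0).
apply/rowP => -[[|[|[|//]]] hi]; rewrite !mxE /=.
- have -> : Ordinal hi = 0 by exact/val_inj.
  rewrite -/a /u /v; lra.
- have -> : Ordinal hi = 1 by exact/val_inj.
  rewrite -/b /u /v; lra.
- have -> : Ordinal hi = 2%:R by exact/val_inj.
  rewrite -/c /w; lra.
Qed.

End D_space.

Definition D_space (R : realType) (e : R) : Type := 'rV[R]_3.

HB.instance Definition _ (R : realType) (e : R) :=
  GRing.Lmodule.copy (D_space e) 'rV[R]_3.

HB.instance Definition _ (R : realType) (e : R) :=
  @Lmodule_isNormed.Build R (D_space e) (minkowski_functional (D_ball e))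
    (minkowski_functionalD (@D_ball_convex R e) (@D_ball_absorbing R e))
    (minkowski_functionalZ (@D_ball_convex R e) (@D_ballN R e)
      (@D_ball_absorbing R e))
    (minkowski_functional_eq0 (@D_ball_convex R e) (@D_ball_absorbing R e)
      (@D_ball_compact R e)).

Lemma D_space_unit_ball (R : realType) (e : R) :
  [set x : D_space e | `|x| <= 1] = D_ball e.
Proof.
exact: (minkowski_functional_unit_ball (@D_ball_convex R e)
  (@D_ball_absorbing R e) (@D_ball_compact R e)).
Qed.

(* Main.v *)
Require Import Defs.
From mathcomp Require Import all_boot all_order all_algebra.
From mathcomp Require Import ring lra.
From mathcomp Require Import all_classical all_reals all_analysis.
From HB Require Import structures.
Import Order.TTheory GRing.Theory Num.Theory.
Import numFieldNormedType.Exports.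
Local Open Scope classical_set_scope.
Local Open Scope ring_scope.

Set Implicit Arguments.
Unset Strict Implicit.
Unset Printing Implicit Defensive.

(* A compactness argument in (x, f) reduces the strict inequality to the
   following: every (x, f) with |x|, |f| <= 1 and f x >= 1 - e^2 / 2 is at
   distance < e from some norming pair, in both components. Maximize
   z |-> f z - (e / 2) |z - x| over the unit ball; at a maximizer y, Hahn-Banach
   splits f = L + t g with |L| <= e / 2 and g norming at y, whence
   |x - y| <= e and |f - g| <= e. The first inequality can be made strict by
   choosing the maximizer. If |f| < 1, shrinking e / 2 makes both strict. If
   |f| = 1 and the second is an equality, then f = (e / 2) h + (1 - e / 2) g with
   h = g = 1 at a vertex where f = 1, and h = 1, g = -1 at another vertex: these
   two vertices span a square, and the only square spanned by vertices of D_e is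
   the one with corners (+-1, +-1, 0). This forces f = (+-e / 2, +-(1 - e / 2), 0)
   or f = (+-(1 - e / 2), +-e / 2, 0), and for these f the vertices A_2, ..., A_9
   provide a better norming pair. *)

(** * Finite-dimensional Hahn-Banach theorem for sublinear functionals *)

Section hahn_banach.
Context {R : realType} {V : lmodType R}.
Implicit Types (q : V -> R) (u v : V) (t : R).

(** Homogeneity is asked only as an inequality, the form in which the infima below satisfy it;
    [sublinearZ] recovers equality by rescaling with the inverse of [t]. *)
Definition sublinear q :=
  (forall u v, q (u + v) <= q u + q v) /\
  (forall (t : R) v, 0 <= t -> q (t *: v) <= t * q v).

Lemma sublinear0 q : sublinear q -> q 0 = 0.
Proof.
move=> [qD qZ]; have := qZ 0 0 (lexx 0); have := qD 0 0.
rewrite scale0r addr0; lra.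
Qed.

Lemma sublinearNge q v : sublinear q -> - q (- v) <= q v.
Proof. by move=> sq; have := sq.1 v (- v); rewrite subrr sublinear0//; lra. Qed.

Lemma sublinearZ q (t : R) v : sublinear q -> 0 <= t -> q (t *: v) = t * q v.
Proof.
move=> sq; rewrite le_eqVlt => /predU1P[<-|t0].
  by rewrite scale0r mul0r sublinear0.
apply/eqP; rewrite eq_le; apply/andP; split; first by apply: sq.2; exact: ltW.
rewrite -ler_pdivlMl//.
have := sq.2 t^-1 (t *: v); rewrite scalerA mulVf ?gt_eqF// scale1r.
by apply; rewrite invr_ge0 ltW.
Qed.

(** Let [q' v] be the infimum of [q (v + t e) - t q e] over [t >= 0]. Taking [t = 0] gives
    [q' <= q], and taking [t = 1] at [- e] gives [q' (- e) <= - q e]. *)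
Lemma sublinear_extend q (e : V) : sublinear q ->
  exists q', [/\ sublinear q', forall v, q' v <= q v & q' e + q' (- e) <= 0].
Proof.
move=> sq; have [qD qZ] := sq.
pose S v := [set q (v + t *: e) - t * q e | t in [set t | 0 <= t]].
pose q' v := inf (S v).
have S0 v : S v !=set0 by exists (q (v + 0 *: e) - 0 * q e); exists 0 => /=.
have q'_ub v (t : R) : 0 <= t -> q' v <= q (v + t *: e) - t * q e.
  move=> t0; apply: ge_inf; last by exists t.
  (* Subadditivity and [q (r e) = r q e] show that no term lies below [- q (- v)], so the infimum is
     a genuine one. *)
  exists (- q (- v)) => _ [r /= r0 <-].
  have := sublinearNge v sq; rewrite -(sublinearZ e sq r0).
  by have := qD (v + r *: e) (- v); rewrite addrAC subrr add0r; lra.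
have le_q' v (c : R) : (forall t : R, 0 <= t -> c <= q (v + t *: e) - t * q e) ->
    c <= q' v.
  by move=> h; apply: lb_le_inf => // _ [t /= t0 <-]; exact: h.
have q'q v : q' v <= q v by have := q'_ub v 0 (lexx 0); rewrite scale0r addr0; lra.
exists q'; split=> //.
- split=> [u v|t v t0].
  + rewrite -lerBlDr; apply: (le_q') => t t0; rewrite lerBlDr -lerBlDl.
    apply: le_q' => s s0; rewrite lerBlDl.
    have := q'_ub (u + v) (t + s) (addr_ge0 t0 s0).
    have := qD (u + t *: e) (v + s *: e); rewrite addrACA -scalerDl; lra.
  + have [->|tn0] := eqVneq t 0.
      by rewrite scale0r mul0r (le_trans (q'q _))// sublinear0.
    have tp : 0 < t by rewrite lt_neqAle eq_sym tn0.
    rewrite -ler_pdivrMl//; apply: le_q' => s s0; rewrite ler_pdivrMl//.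
    have := q'_ub (t *: v) (t * s) (mulr_ge0 t0 s0).
    by have := qZ t (v + s *: e) t0; rewrite scalerDr scalerA; lra.
- have := q'_ub (- e) 1 ler01; rewrite scale1r addNr sublinear0//.
  by have := q'q e; lra.
Qed.

(** Treating the vectors of a spanning family one after the other yields a sublinear functional that
    is odd everywhere, hence linear. Lowering the functional further does not spoil the vectors
    already treated. *)
Lemma hahn_banach_fin q (s : seq V) : sublinear q ->
  (forall v, exists c : 'I_(size s) -> R, v = \sum_i c i *: s`_i) ->
  exists L : {linear V -> R^o}, forall v, L v <= q v.
Proof.
move=> sq span.
have [q' [sq' q'q q's]] : exists q', [/\ sublinear q', forall v, q' v <= q v &
    forall v, v \in s -> q' v + q' (- v) <= 0].
  elim: s {span} => [|e s [q1 [sq1 q1q q1s]]]; first by exists q.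
  have [q2 [sq2 q2q1 q2e]] := sublinear_extend e sq1; exists q2; split=> //.
    by move=> v; apply: le_trans (q1q v).
  move=> v; rewrite inE => /orP[/eqP->//|vs].
  by have := q1s _ vs; have := q2q1 v; have := q2q1 (- v); lra.
have [q'D q'Z] := sq'.
have q'N v : q' (- v) = - q' v.
  suff : q' v + q' (- v) <= 0.
    by have := sublinearNge v sq'; lra.
  have [c ->] := span v.
  apply: (big_ind (fun v => q' v + q' (- v) <= 0)).
  - by rewrite oppr0 sublinear0// addr0.
  - move=> u w hu hw; rewrite opprD.
    by have := q'D u w; have := q'D (- u) (- w); lra.
  - move=> i _; have hs := q's _ (mem_nth 0 (ltn_ord i)).
    have [c0|c0] := leP 0 (c i).
      rewrite -scalerN; have := q'Z (c i) s`_i c0; have := q'Z (c i) (- s`_i) c0.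
      by have := ler_wpM2l c0 hs; lra.
    have c0' : 0 <= - c i by rewrite oppr_ge0 ltW.
    have := q'Z (- c i) s`_i c0'; have := q'Z (- c i) (- s`_i) c0'.
    by rewrite !(scalerN, scaleNr) opprK; have := ler_wpM2l c0' hs; lra.
have q'Dl u v : q' (u + v) = q' u + q' v.
  apply/eqP; rewrite eq_le q'D /=.
  by have := q'D (- u) (- v); rewrite -opprD !q'N; lra.
have q'Zl (t : R) v : q' (t *: v) = t * q' v.
  have [t0|t0] := leP 0 t; first exact: sublinearZ.
  by rewrite -[t in LHS]opprK scaleNr q'N sublinearZ ?oppr_ge0 ?ltW//; lra.
have lin : linear (q' : V -> R^o) by move=> t u v; rewrite q'Dl q'Zl.
pose L : {linear V -> R^o} :=
  HB.pack (q' : V -> R^o) (GRing.isLinear.Build _ _ _ _ (q' : V -> R^o) lin).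
by exists L.
Qed.

End hahn_banach.

(** * Splitting a functional at a maximum of a penalized functional *)

Section perturbation.
Context {R : realType} {X : normedModType R} (s : seq X).
Hypothesis span : forall v : X, exists c : 'I_(size s) -> R,
  v = \sum_i c i *: s`_i.
Variables (f : {linear X -> R^o}) (x : X) (k : R).
Hypothesis k0 : 0 <= k.

(** Let [q v] be the infimum of [k |v + a (z - x)| - a (f z - M)] over [a >= 0] and [z] in the ball.
    Any linear [L <= q] will do: [a = 0] gives the first claim, and [v = x - z] with [a = 1] gives
    the second. *)
Lemma ball_affine_minorant (M : R) :
  (forall z, `|z| <= 1 -> f z - k * `|z - x| <= M) ->
  exists L : {linear X -> R^o}, (forall v, L v <= k * `|v|) /\
    (forall z, `|z| <= 1 -> f z - L (z - x) <= M).
Proof.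
move=> fM.
pose S v := [set k * `|v + p.1 *: (p.2 - x)| - p.1 * (f p.2 - M) |
  p in [set p : R * X | 0 <= p.1 /\ `|p.2| <= 1]].
pose q v := inf (S v).
have b0 : `|0 : X| <= 1 by rewrite normr0.
have S0 v : S v !=set0.
  by exists (k * `|v + 0 *: (0 - x)| - 0 * (f 0 - M)); exists (0, 0).
have q_ub v (a : R) z : 0 <= a -> `|z| <= 1 ->
    q v <= k * `|v + a *: (z - x)| - a * (f z - M).
  move=> a0 z1; apply: ge_inf; last by exists (a, z).
  exists (- (k * `|v|)) => _ [[c w] /= [c0 w1] <-].
  (* The lower bound [- k |v|] follows from [fM] scaled by [c] together with this triangle
     inequality. *)
  have h : c * `|w - x| <= `|v + c *: (w - x)| + `|v|.
    rewrite -{1}(ger0_norm c0) -normrZ.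
    rewrite -{1}[c *: _](addKr v) addrC (le_trans (ler_normB _ _))//.
  have := ler_wpM2l k0 h; have := ler_wpM2l c0 (fM _ w1); lra.
have le_q v (m : R) : (forall (a : R) z, 0 <= a -> `|z| <= 1 ->
    m <= k * `|v + a *: (z - x)| - a * (f z - M)) -> m <= q v.
  by move=> h; apply: lb_le_inf => // _ [[a z] /= [a0 z1] <-]; exact: h.
have qk v : q v <= k * `|v|.
  by have := q_ub v 0 0 (lexx 0) b0; rewrite scale0r addr0; lra.
have sq : sublinear q.
  split=> [u v|t v].
    rewrite -lerBlDr; apply: (le_q) => a z a0 z1; rewrite lerBlDr -lerBlDl.
    apply: (le_q) => c w c0 w1; rewrite lerBlDl.
    have [ac0|ac0] := eqVneq (a + c) 0.
      have a0' : a = 0 by lra.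
      have c0' : c = 0 by lra.
      rewrite a0' c0' !scale0r !addr0 !mul0r !subr0.
      by rewrite (le_trans (qk _))// -mulrDr ler_wpM2l// ler_normD.
    have acp : 0 < a + c by rewrite lt_neqAle eq_sym ac0 addr_ge0.
    (* This convex combination merges [a (z - x) + c (w - x)] into [(a + c) (p - x)]. *)
    pose p := (a + c)^-1 *: (a *: z + c *: w).
    have pE : (a + c) *: p = a *: z + c *: w by rewrite scalerA divff// scale1r.
    have p1 : `|p| <= 1.
      rewrite normrZ gtr0_norm ?invr_gt0// ler_pdivrMl// mulr1.
      rewrite (le_trans (ler_normD _ _))// !normrZ !ger0_norm//.
      by rewrite lerD// ler_piMr.
    have := q_ub (u + v) _ _ (ltW acp) p1.
    have -> : u + v + (a + c) *: (p - x) =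
        (u + a *: (z - x)) + (v + c *: (w - x)).
      rewrite scalerBr pE scalerDl !scalerBr opprD !addrA.
      by rewrite [RHS](ACl (1*4*2*5*3*6)).
    have : (a + c) * f p = a * f z + c * f w.
      have <- : f ((a + c) *: p) = (a + c) * f p by rewrite linearZ.
      by rewrite pE linearD !linearZ.
    have := ler_wpM2l k0 (ler_normD (u + a *: (z - x)) (v + c *: (w - x))).
    lra.
  rewrite le_eqVlt => /predU1P[<-|t0].
    by rewrite scale0r mul0r (le_trans (qk _))// normr0 mulr0.
  rewrite -ler_pdivrMl//; apply: le_q => a z a0 z1; rewrite ler_pdivrMl//.
  have := q_ub (t *: v) _ _ (mulr_ge0 (ltW t0) a0) z1.
  by rewrite -scalerA -scalerDr normrZ gtr0_norm//; lra.
have [L Lq] := hahn_banach_fin sq span; exists L; split.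
  by move=> v; exact: le_trans (Lq v) (qk v).
move=> z z1; have := le_trans (Lq _) (q_ub (- (z - x)) 1 z ler01 z1).
by rewrite scale1r addNr normr0 linearN; lra.
Qed.

(* When the maximizer [y0] is too far from [x], then [x] is another maximizer. *)
Lemma ball_perturbation y0 : `|x| <= 1 -> `|y0| <= 1 ->
  (forall z, `|z| <= 1 -> f z - k * `|z - x| <= f y0 - k * `|y0 - x|) ->
  exists (y : X) (L : {linear X -> R^o}), [/\ `|y| <= 1,
    k * `|y - x| <= f y - f x,
    y = x \/ k * `|y - x| < f y - f x,
    forall v, `|L v| <= k * `|v| &
    forall z, `|z| <= 1 -> f z - L z <= f y - L y].
Proof.
move=> x1 y01 ymax.
have [y [y1 yx ymax' yx']] : exists y, [/\ `|y| <= 1, k * `|y - x| <= f y - f x,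
    forall z, `|z| <= 1 -> f z - k * `|z - x| <= f y - k * `|y - x| &
    y = x \/ k * `|y - x| < f y - f x].
  have := ymax _ x1; rewrite subrr normr0 mulr0 subr0 => h.
  have [h'|h'] := ltP (k * `|y0 - x|) (f y0 - f x).
    by exists y0; split=> //; [lra|right].
  exists x; split; rewrite ?subrr ?normr0 ?mulr0 ?subr0//; last by left.
  by move=> z z1; have := ymax _ z1; lra.
have [L [Lk LM]] := ball_affine_minorant ymax'.
exists y, L; split=> //.
  move=> v; rewrite ler_norml Lk andbT lerNl -linearN.
  by rewrite (le_trans (Lk _))// normrN.
(* As [L (y - x) <= k |y - x|], the bound [f y - k |y - x|] is at most [f y - L (y - x)], so [f - L]
   is maximal at [y]. *)
move=> z z1; have := LM _ z1; have := LM _ y1; have := Lk (y - x).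
by rewrite !linearB /=; lra.
Qed.

End perturbation.

(** * Coordinates and vertices of the space *)

Section D_geometry.
Context {R : realType} (e : R).
Hypotheses (e0 : 0 < e) (e1 : e < 1).
Local Notation X := (D_space e).

(* The flag exchanges the first two coordinates. *)
Definition pt (s : bool) (a b c : R) : X :=
  if s then point3 b a c else point3 a b c.

Lemma ptD s a b c a' b' c' :
  pt s a b c + pt s a' b' c' = pt s (a + a') (b + b') (c + c').
Proof. by case: s; apply/rowP => -[[|[|[|//]]] hi]; rewrite !mxE. Qed.

Lemma ptZ s t a b c : t *: pt s a b c = pt s (t * a) (t * b) (t * c).
Proof. by case: s; apply/rowP => -[[|[|[|//]]] hi]; rewrite !mxE. Qed.

Lemma ptN s a b c : - pt s a b c = pt s (- a) (- b) (- c).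
Proof. by rewrite -scaleN1r ptZ !mulN1r. Qed.

Lemma ptE s (x : X) : exists a b c, x = pt s a b c.
Proof.
pose y : 'rV[R]_3 := x; case: s.
  exists (y 0 1), (y 0 0), (y 0 2%:R).
  by apply/rowP => -[[|[|[|//]]] hi]; rewrite !mxE /=; congr (y _ _); exact/val_inj.
exists (y 0 0), (y 0 1), (y 0 2%:R).
by apply/rowP => -[[|[|[|//]]] hi]; rewrite !mxE /=; congr (y _ _); exact/val_inj.
Qed.

(** The 22 points are invariant under sign changes of each coordinate and under exchange of the
    first two, so absolute values describe them, whatever the flag of [pt]. *)
Definition D_vertex (a b c : R) :=
  [\/ [/\ a = 0, b = 0 & `|c| = 3 / 4],
      [/\ `|a| = 1 - e, `|b| = 1 & `|c| = e / 2],
      [/\ `|a| = 1, `|b| = 1 - e & `|c| = e / 2] |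
      [/\ `|a| = 1, `|b| = 1 & c = 0]].

Lemma D_vertexN a b c : D_vertex a b c -> D_vertex (- a) (- b) (- c).
Proof.
move=> [] [ha hb hc]; [apply: Or41|apply: Or42|apply: Or43|apply: Or44];
  by split; rewrite ?normrN// ?ha ?hb ?hc oppr0.
Qed.

Lemma D_points_vertex s (x : X) : x \in (D_points e : seq X) ->
  exists a b c, x = pt s a b c /\ D_vertex a b c.
Proof.
have n1 : `|1 : R| = 1 by rewrite normr1.
have n1' : `|-1 : R| = 1 by rewrite normrN1.
have ne : `|1 - e| = 1 - e by rewrite ger0_norm// subr_ge0 ltW.
have ne' : `|e - 1| = 1 - e by rewrite distrC.
have ne2 : `|e / 2| = e / 2 by rewrite gtr0_norm// divr_gt0.
have h : x \in (D_points e : seq X) ->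
    exists a b c, x = pt false a b c /\ D_vertex a b c.
  rewrite !inE => /or4P[/eqP->|/eqP->|/eqP->|].
  - by exists 0, 0, (3 / 4); split=> //; apply: Or41; split=> //; rewrite ger0_norm.
  - by exists (1 - e), 1, (e / 2); split=> //; apply: Or42.
  - by exists (1 - e), (-1), (e / 2); split=> //; apply: Or42.
  move=> /or4P[/eqP->|/eqP->|/eqP->|].
  - by exists (e - 1), 1, (e / 2); split=> //; apply: Or42.
  - by exists (e - 1), (-1), (e / 2); split=> //; apply: Or42.
  - by exists 1, (1 - e), (e / 2); split=> //; apply: Or43.
  move=> /or4P[/eqP->|/eqP->|/eqP->|/orP[]/eqP->].
  - by exists (-1), (1 - e), (e / 2); split=> //; apply: Or43.
  - by exists 1, (e - 1), (e / 2); split=> //; apply: Or43.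
  - by exists (-1), (e - 1), (e / 2); split=> //; apply: Or43.
  - by exists 1, 1, 0; split=> //; apply: Or44.
  - by exists 1, (-1), 0; split=> //; apply: Or44.
move=> /h[a [b [c [-> v]]]]; case: s; last by exists a, b, c.
exists b, a, c; split=> //.
by case: v => [] [ha hb hc]; [apply: Or41|apply: Or43|apply: Or42|apply: Or44].
Qed.

Lemma norm_D_points (x : X) : x \in (D_points e : seq X) -> `|x| <= 1.
Proof.
move=> xp; have : D_ball e x by exact: sub_abs_convex_hull.
by rewrite -D_space_unit_ball.
Qed.

Lemma norm_D_vertex s a b c : D_vertex a b c -> `|pt s a b c| <= 1.
Proof.
have norm_eq (u v : R) : `|u| = v -> u = v \/ u = - v.
  by move=> <-; case: (ger0P u) => _; [left|right]; rewrite ?opprK.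
have key (a' b' c' : R) : point3 a' b' c' \in D_points e \/
    point3 (- a') (- b') (- c') \in D_points e ->
    `|pt false a' b' c'| <= 1.
  move=> [h|h]; first exact: (@norm_D_points (point3 a' b' c')).
  by rewrite -normrN ptN; exact: (@norm_D_points (point3 _ _ _)).
have h a' b' c' : D_vertex a' b' c' -> `|pt false a' b' c'| <= 1.
  move=> v; apply: key; move: v.
  by case=> -[] => [->->/norm_eq[]->|/norm_eq[]->/norm_eq[]->/norm_eq[]->
    |/norm_eq[]->/norm_eq[]->/norm_eq[]->|/norm_eq[]->/norm_eq[]->->];
    rewrite ?opprK ?oppr0 ?opprB !inE !eqxx ?orbT; auto.
case: s => v; last exact: h.
apply: h; case: v => [] [ha hb hc].
- by apply: Or41.
- by apply: Or43.
- by apply: Or42.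
- by apply: Or44.
Qed.

Lemma pt_linear (f : {linear X -> R^o}) s : exists p q r,
  forall a b c, f (pt s a b c) = a * p + b * q + c * r.
Proof.
exists (f (pt s 1 0 0)), (f (pt s 0 1 0)), (f (pt s 0 0 1)) => a b c.
have -> : pt s a b c = a *: pt s 1 0 0 + b *: pt s 0 1 0 + c *: pt s 0 0 1.
  by rewrite !ptZ !ptD !mulr1 !mulr0 !addr0 !add0r.
by rewrite !linearD !linearZ.
Qed.

Definition pt_form s (p q r : R) (x : X) : R^o :=
  let y : 'rV[R]_3 := x in
  (if s then y 0 1 else y 0 0) * p + (if s then y 0 0 else y 0 1) * q
    + y 0 2%:R * r.

Lemma pt_form_is_linear s p q r : linear (pt_form s p q r).
Proof. by case: s => t x y; rewrite /pt_form !mxE /=; rewrite /GRing.scale/=; ring. Qed.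

HB.instance Definition _ s p q r :=
  GRing.isLinear.Build R X R^o *:%R (pt_form s p q r) (pt_form_is_linear s p q r).

Lemma pt_formE s p q r a b c :
  pt_form s p q r (pt s a b c) = a * p + b * q + c * r.
Proof. by case: s; rewrite /pt_form !mxE. Qed.

End D_geometry.

(** * The dual norm as a maximum over the vertices *)

Section D_dual.
Context {R : realType} (e : R).
Hypotheses (e0 : 0 < e) (e1 : e < 1).
Local Notation X := (D_space e).
Implicit Types (f g : {linear X -> R^o}) (c : R) (x : X).

(** The set where [|f| <= c] is convex and symmetric, so it contains the whole hull once it contains
    the points. *)
Lemma D_form_le f c :
    (forall x, x \in (D_points e : seq X) -> `|f x : R| <= c) ->
  forall x, `|x| <= 1 -> `|f x : R| <= c.
Proof.
move=> fc x x1; have : D_ball e x by rewrite -D_space_unit_ball.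
move=> /(_ [set y | `|f (y : X) : R| <= c]); apply; split.
  apply/convex_setP => y z a b a0' b0 ab /= yc zc.
  have fE : f (a *: (y : X) + b *: (z : X)) = a * f y + b * f z :> R.
    by rewrite linearD !linearZ.
  change (`|f (a *: (y : X) + b *: (z : X)) : R| <= c); rewrite fE.
  rewrite (le_trans (ler_normD _ _))// !normrM (ger0_norm a0') (ger0_norm b0).
  by rewrite -[c]mul1r -ab mulrDl lerD// ler_wpM2l.
move=> y [yp|[z zp <-]] /=; first exact: fc.
change (`|f (- (z : X)) : R| <= c).
by rewrite linearN normrN; exact: fc.
Qed.

Lemma dual_norm_ge f x : `|x| <= 1 -> `|f x : R| <= dual_norm f.
Proof.
move=> x1; apply: ub_le_sup; last by exists x.
(* The maximum over the points is an upper bound, so the [sup] in [dual_norm] is a genuine one. *)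
exists (\big[Order.max/0]_(v <- D_points e) `|f (v : X) : R|).
move=> _ [y /= y1 <-]; apply: D_form_le y y1 => v vp.
by apply: le_bigmax_seq vp _.
Qed.

Lemma dual_norm_le f c :
    (forall x, x \in (D_points e : seq X) -> `|f x : R| <= c) ->
  dual_norm f <= c.
Proof.
move=> fc; apply: ge_sup.
  by exists `|f 0 : R|; exists 0 => //=; rewrite normr0.
by move=> _ [x /= x1 <-]; exact: D_form_le fc x x1.
Qed.

Lemma dual_norm_attained f :
  exists2 x, x \in (D_points e : seq X) & dual_norm f = `|f x : R|.
Proof.
pose F (v : X) : R := `|f v : R|.
have [v vp vmax] : exists2 v : X, v \in (D_points e : seq X) &
    forall w : X, w \in (D_points e : seq X) -> F w <= F v.
  elim: (D_points e : seq X) (isT : (D_points e : seq X) != [::]) => // a s IH _.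
  have [->|/IH[v vs vmax]] := eqVneq s [::].
    by exists a; rewrite ?mem_head// => w; rewrite inE => /eqP ->.
  have [h|h] := leP (F a) (F v).
    exists v; first by rewrite inE vs orbT.
    by move=> w; rewrite inE => /orP[/eqP->//|/vmax].
  exists a; rewrite ?mem_head// => w; rewrite inE => /orP[/eqP->//|/vmax].
  by move=> /le_trans -> //; exact: ltW.
exists v => //; apply/eqP; rewrite eq_le dual_norm_le//=.
exact/dual_norm_ge/norm_D_points.
Qed.

Lemma dual_norm_bound f x : `|f x : R| <= dual_norm f * `|x|.
Proof.
have [->|x0] := eqVneq x 0; first by rewrite linear0 !normr0 mulr0.
have nx : 0 < `|x| by rewrite normr_gt0.
have := @dual_norm_ge f (`|x|^-1 *: x).
rewrite normrZ gtr0_norm ?invr_gt0// mulVf ?gt_eqF// => /(_ (lexx _)).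
by rewrite linearZ normrM gtr0_norm ?invr_gt0// ler_pdivrMl// mulrC.
Qed.

Lemma D_form_continuous f : continuous f.
Proof.
apply: bounded_linear_continuous; apply/linear_boundedP.
exists (dual_norm f); split; first exact: num_real.
move=> r fr x; apply: le_trans (dual_norm_bound f x) _.
by rewrite ler_wpM2r// ltW.
Qed.

End D_dual.

(** * The dual ball in coordinates, norm estimates and the exceptional functionals *)

Section D_extremal.
Context {R : realType} (e : R).
Hypotheses (e0 : 0 < e) (e1 : e < 1).
Local Notation X := (D_space e).
Implicit Types (f g : {linear X -> R^o}) (x y : X) (a b c p q r : R).

(** The dual unit ball in coordinates: by sign symmetry, each of the four classes of vertices
    contributes a single inequality. *)
Definition D_dual p q r :=
  [/\ 3 / 4 * `|r| <= 1, (1 - e) * `|p| + `|q| + e / 2 * `|r| <= 1,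
      `|p| + (1 - e) * `|q| + e / 2 * `|r| <= 1 & `|p| + `|q| <= 1].

Lemma D_dual_vertex p q r a b c : D_dual p q r -> D_vertex e a b c ->
  `|a| * `|p| + `|b| * `|q| + `|c| * `|r| <= 1.
Proof. by move=> [h1 h2 h3 h4] [] [-> -> ->]; rewrite ?normr0; lra. Qed.

Lemma dual_norm_pt_form s p q r : D_dual p q r ->
  dual_norm (pt_form s p q r : X -> R^o) <= 1.
Proof.
move=> d; apply: (@dual_norm_le _ e) => // x /(D_points_vertex e0 e1 s).
move=> [a [b [c [-> v]]]]; rewrite /= pt_formE.
rewrite (le_trans (ler_normD _ _))// (le_trans (lerD (ler_normD _ _) (lexx _)))//.
by rewrite !normrM; exact: D_dual_vertex.
Qed.

(** In each class there is a vertex whose signs match those of [p], [q], [r]; the bound on [f] there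
    is an inequality between absolute values. *)
Lemma D_dual_form s f p q r :
    (forall x, `|x| <= 1 -> f x <= 1) ->
    (forall a b c, f (pt e s a b c) = a * p + b * q + c * r) ->
  D_dual p q r.
Proof.
move=> f1 fE; have [] : exists (P Q T : R), [/\ `|P| = 1, `|Q| = 1, `|T| = 1 &
    [/\ P * p = `|p|, Q * q = `|q| & T * r = `|r|]].
  have sg u : exists2 S : R, `|S| = 1 & S * u = `|u|.
    case: (ger0P u) => _; first by exists 1; rewrite ?normr1 ?mul1r.
    by exists (-1); rewrite ?normrN1 ?mulN1r.
  have [P P1 Pp] := sg p; have [Q Q1 Qq] := sg q; have [T T1 Tr] := sg r.
  by exists P, Q, T.
move=> P [Q [T [P1 Q1 T1 [Pp Qq Tr]]]].
have v a b c m : m = a * p + b * q + c * r -> D_vertex e a b c -> m <= 1.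
  by move=> -> /(norm_D_vertex s) /f1; rewrite fE.
have ne u : `|u| = 1 -> `|(1 - e) * u| = 1 - e.
  by move=> u1; rewrite normrM u1 mulr1 gtr0_norm// subr_gt0.
have ne2 : `|e / 2 * T| = e / 2.
  by rewrite normrM T1 mulr1 gtr0_norm// divr_gt0.
split.
- apply: (v 0 0 (3 / 4 * T)); first by rewrite -Tr; ring.
  by apply: Or41; split=> //; rewrite normrM T1 mulr1 ger0_norm.
- apply: (v ((1 - e) * P) Q (e / 2 * T)); first by rewrite -Pp -Qq -Tr; ring.
  by apply: Or42; split=> //; exact: ne.
- apply: (v P ((1 - e) * Q) (e / 2 * T)); first by rewrite -Pp -Qq -Tr; ring.
  by apply: Or43; split=> //; exact: ne.
- apply: (v P Q 0); first by rewrite -Pp -Qq; ring.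
  by apply: Or44; split.
Qed.

(** Writing [a = u + v] and [b = u - v] gives [|u| + |v| = max(|a|, |b|)], where [u] and [v] are the
    coefficients along (1, 1, 0) and (1, -1, 0). *)
Lemma norm_pt_square s a b (m : R) : `|a| <= m -> `|b| <= m -> `|pt e s a b 0| <= m.
Proof.
move=> am bm.
have [u [v [aE bE]]] : exists u v : R, a = u + v /\ b = u - v.
  by exists ((a + b) / 2), ((a - b) / 2); split; lra.
have -> : pt e s a b 0 = u *: pt e s 1 1 0 + v *: pt e s 1 (-1) 0.
  by rewrite !ptZ ptD aE bE; congr (pt _ _ _ _ _); lra.
have n1 : `|pt e s 1 1 0| <= 1.
  by apply: norm_D_vertex => //; apply: Or44; split; rewrite ?normr1.
have n2 : `|pt e s 1 (-1) 0| <= 1.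
  by apply: norm_D_vertex => //; apply: Or44; split; rewrite ?normr1 ?normrN1.
rewrite (le_trans (ler_normD _ _))// !normrZ.
have := ler_piMr (normr_ge0 u) n1; have := ler_piMr (normr_ge0 v) n2.
move: am bm; rewrite aE bE !ler_norml => /andP[? ?] /andP[? ?].
by case: (ger0P u); case: (ger0P v); lra.
Qed.

Lemma norm_pt_axis s c : `|pt e s 0 0 c| <= 4 / 3 * `|c|.
Proof.
have -> : pt e s 0 0 c = (4 / 3 * c) *: pt e s 0 0 (3 / 4).
  by rewrite !ptZ; congr (pt _ _ _ _ _); lra.
rewrite normrZ normrM (ger0_norm (_ : 0 <= 4 / 3)) ?ler_piMr//.
by apply: norm_D_vertex => //; apply: Or41; split=> //; rewrite ger0_norm.
Qed.

(** Both norms must be 1, since [1 = g y] is at most their product. *)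
Lemma norming_pairsI y g : `|y| <= 1 -> dual_norm g <= 1 -> g y = 1 ->
  norming_pairs (y, g).
Proof.
move=> y1 g1 gy; have dg : 1 <= dual_norm g.
  by rewrite -[leLHS](normr1 R) -gy dual_norm_ge.
split=> //=; [exact: D_form_continuous| |by apply/eqP; rewrite eq_le g1].
apply/eqP; rewrite eq_le y1/= leNgt; apply/negP => y1'.
have := dual_norm_bound g y; rewrite gy normr1.
by have := ler_wpM2r (normr_ge0 y) g1; lra.
Qed.

(* Up to symmetries these are the only functionals at which the estimate of
   [ball_perturbation] is not strict. For [p, q >= 0], take [y] on the edge from
   (1, 1, 0) to (1 - e, 1, +-e / 2), where (e / 2, 1 - e / 2, +-e) is norming. *)
Lemma D_bpb_corner s f x p q :
    (forall a b c, f (pt e s a b c) = a * p + b * q) ->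
    `|p| = e / 2 -> `|q| = 1 - e / 2 -> `|x| <= 1 -> 1 - e ^+ 2 / 2 <= f x ->
  exists y g, [/\ norming_pairs (y, g), `|x - y| < e & dual_norm (f \- g) < e].
Proof.
move=> fE pe qe x1 fx; have [a [b [c xE]]] := ptE s x.
have [P P1 Pp] : exists2 P : R, P = 1 \/ P = -1 & p = P * (e / 2).
  by rewrite -pe; case: (ger0P p) => _; [exists 1|exists (-1)]; (by [left|right]) || lra.
have [Q Q1 Qq] : exists2 Q : R, Q = 1 \/ Q = -1 & q = Q * (1 - e / 2).
  by rewrite -qe; case: (ger0P q) => _; [exists 1|exists (-1)]; (by [left|right]) || lra.
have [T T1 Tc] : exists2 T : R, T = 1 \/ T = -1 & c = T * `|c|.
  by case: (ger0P c) => _; [exists 1|exists (-1)]; (by [left|right]) || lra.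
have nS (S : R) : S = 1 \/ S = -1 -> `|S| = 1.
  by case=> ->; rewrite ?normr1 ?normrN1.
have SS (S : R) : S = 1 \/ S = -1 -> S * S = 1 by case=> ->; lra.
set w := `|c| in Tc; have w0 : 0 <= w by exact: normr_ge0.
(* Up to signs, [x] is [(1 - t, 1 - u, w)]; [t] and [u] measure how far it is from the corner
   [(P, Q, 0)]. *)
pose t := 1 - P * a; pose u := 1 - Q * b.
have aE : a = P * (1 - t).
  by rewrite /t; case: P1 => ->; lra.
have bE : b = Q * (1 - u).
  by rewrite /u; case: Q1 => ->; lra.
have form p' q' r' : D_dual p' q' r' -> a * p' + b * q' + c * r' <= 1.
  move=> d; rewrite -(pt_formE e s) -xE (le_trans (ler_norm _))//.
  exact: le_trans (dual_norm_ge _ x1) (dual_norm_pt_form s d).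
have t0 : 0 <= t.
  have := form P 0 0; rewrite /t => h; suff : D_dual P 0 0 by move=> /h; lra.
  by split; rewrite ?(nS _ P1) ?normr0; have := e0; lra.
have u0 : 0 <= u.
  have := form 0 Q 0; rewrite /u => h; suff : D_dual 0 Q 0 by move=> /h; lra.
  by split; rewrite ?(nS _ Q1) ?normr0; have := e0; lra.
(* The functional with coefficients [P / 2], [Q / 2], [T] lies in the dual ball, and testing it on
   [x] bounds the height [w]. *)
have wtu : w <= (t + u) / 2.
  have := form (P / 2) (Q / 2) T; rewrite aE bE Tc => h.
  suff /h : D_dual (P / 2) (Q / 2) T.
    rewrite -!mulrA; move: (SS _ P1) (SS _ Q1) (SS _ T1).
    have -> : P * ((1 - t) * (P / 2)) = (P * P) * ((1 - t) / 2) by ring.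
    have -> : Q * ((1 - u) * (Q / 2)) = (Q * Q) * ((1 - u) / 2) by ring.
    have -> : T * (w * T) = (T * T) * w by ring.
    by move=> -> -> ->; lra.
  split; rewrite ?normrM ?(nS _ P1) ?(nS _ Q1) ?(nS _ T1) ?(@ger0_norm _ 2^-1)//;
    by have := e0; lra.
have tu : e / 2 * t + (1 - e / 2) * u <= e ^+ 2 / 2.
  move: fx; rewrite xE fE aE bE Pp Qq.
  have -> : P * (1 - t) * (P * (e / 2)) = (P * P) * ((1 - t) * (e / 2)) by ring.
  have -> : Q * (1 - u) * (Q * (1 - e / 2)) = (Q * Q) * ((1 - u) * (1 - e / 2)).
    by ring.
  by rewrite (SS _ P1) (SS _ Q1); lra.
have he0 := e0; have he1 := e1.
have ge2 : 0 < 1 - e / 2 by lra.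
have ge2' : 0 < e / 2 by lra.
rewrite expr2 in tu.
have te : t <= e.
  by rewrite -(ler_pM2l ge2'); have := mulr_ge0 (ltW ge2) u0; lra.
(* Since [(1 - e / 2) - e / 2 = 1 - e], this turns [(1 - e / 2) u <= (e / 2) (e - t)] into
   [u <= e - t]. *)
have te' : 0 <= (1 - e) * (e - t) by apply: mulr_ge0; lra.
have tue : u <= e - t by rewrite -(ler_pM2l ge2); lra.
have ue : u < e.
  rewrite -(ltr_pM2l ge2); have h : 0 < e * (1 - e) by apply: mulr_gt0; lra.
  by have := mulr_ge0 (ltW ge2') t0; lra.
(* If [w >= t / 2], matching the third coordinate of [x] leaves an error of at most [u]. Otherwise
   [t > 0], and matching the first coordinate leaves at most [u + 2 t / 3], which is below [e]
   because [u <= e - t]. *)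
have [z [z0 ze yE]] : exists z : R, [/\ 0 <= z, z <= e &
    `|x - pt e s (P * (1 - z)) Q (T * (z / 2))| < e].
  have [wt|wt] := leP (t / 2) w.
    exists (2 * w); split; [lra|lra|].
    have -> : x - pt e s (P * (1 - 2 * w)) Q (T * (2 * w / 2)) =
        pt e s (P * (2 * w - t)) (Q * - u) 0.
      by rewrite xE ptN ptD Tc aE bE; congr (pt _ _ _ _ _); lra.
    apply: le_lt_trans ue; apply: norm_pt_square.
      by rewrite normrM (nS _ P1) mul1r ger0_norm; lra.
    by rewrite normrM (nS _ Q1) mul1r normrN ger0_norm.
  exists t; split=> //.
  have -> : x - pt e s (P * (1 - t)) Q (T * (t / 2)) =
      pt e s 0 (Q * - u) 0 + pt e s 0 0 (T * (w - t / 2)).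
    by rewrite xE ptN !ptD Tc aE bE; congr (pt _ _ _ _ _); lra.
  rewrite (le_lt_trans (ler_normD _ _))//.
  have h1 : `|pt e s 0 (Q * - u) 0| <= u.
    by apply: norm_pt_square; rewrite ?normr0// normrM (nS _ Q1) mul1r normrN ger0_norm.
  have h2 : `|pt e s 0 0 (T * (w - t / 2))| <= 4 / 3 * (t / 2 - w).
    by rewrite (le_trans (norm_pt_axis _ _))// normrM (nS _ T1) mul1r ler0_norm; lra.
  by apply: (le_lt_trans (lerD h1 h2)); lra.
(* The third coefficient [e] makes the second inequality of [D_dual] an equality, so [g] is 1 at
   both ends of the edge and hence on all of it. *)
pose g : {linear X -> R^o} := pt_form s (P * (e / 2)) (Q * (1 - e / 2)) (T * e).
have gd : dual_norm g <= 1.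
  apply: dual_norm_pt_form; split; rewrite ?(normrM P) ?(normrM Q) ?(normrM T);
    rewrite ?(nS _ P1) ?(nS _ Q1) ?(nS _ T1) ?(gtr0_norm ge2) ?(gtr0_norm ge2');
    by rewrite ?(gtr0_norm e0); nra.
exists (pt e s (P * (1 - z)) Q (T * (z / 2))), g; split=> //.
  apply: norming_pairsI => //.
    have -> : pt e s (P * (1 - z)) Q (T * (z / 2)) =
        (1 - z / e) *: pt e s P Q 0 + (z / e) *: pt e s (P * (1 - e)) Q (T * (e / 2)).
      by rewrite !ptZ ptD; congr (pt _ _ _ _ _); field; rewrite gt_eqF.
    have ze0 : 0 <= z / e by rewrite divr_ge0// ltW.
    have ze1 : 0 <= 1 - z / e by rewrite subr_ge0 ler_pdivrMr// mul1r.
    have n1 : `|pt e s P Q 0| <= 1.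
      by apply: norm_D_vertex => //; apply: Or44; split=> //; exact: nS.
    have n2 : `|pt e s (P * (1 - e)) Q (T * (e / 2))| <= 1.
      apply: norm_D_vertex => //; apply: Or42; split; last 2 first.
      - exact: nS.
      - by rewrite normrM (nS _ T1) mul1r gtr0_norm.
      - by rewrite normrM (nS _ P1) mul1r gtr0_norm// subr_gt0.
    rewrite (le_trans (ler_normD _ _))// (normrZ (1 - z / e)) (normrZ (z / e)).
    rewrite (ger0_norm ze0) (ger0_norm ze1).
    by have := ler_piMr ze0 n2; have := ler_piMr ze1 n1; lra.
  rewrite /g /= pt_formE.
  have -> : P * (1 - z) * (P * (e / 2)) = (P * P) * ((1 - z) * (e / 2)) by ring.
  have -> : T * (z / 2) * (T * e) = (T * T) * (z / 2 * e) by ring.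
  by rewrite mulrA (SS _ P1) (SS _ Q1) (SS _ T1); lra.
(* [f] and [g] differ only in the third coefficient, by [e] in absolute value, and the third
   coordinate of a vertex is at most 3/4 in absolute value. *)
have [v + ->] := dual_norm_attained (f \- g).
move=> /(D_points_vertex e0 e1 s)[a' [b' [c' [-> vv]]]].
rewrite /g /= fE pt_formE Pp Qq.
have -> : a' * (P * (e / 2)) + b' * (Q * (1 - e / 2)) -
    (a' * (P * (e / 2)) + b' * (Q * (1 - e / 2)) + c' * (T * e)) = - (c' * (T * e)).
  by ring.
rewrite normrN (normrM c') (normrM T) (nS _ T1) mul1r (gtr0_norm e0).
by case: vv => [] [_ _ ->]; rewrite ?normr0; nra.
Qed.

End D_extremal.

(** * Two functionals taking extreme values at two common vertices *)

Section D_equality.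
Context {R : realType} (e : R).
Hypotheses (e0 : 0 < e) (e1 : e < 1).
Implicit Types (a b c p q r : R).

(** The sum of the absolute values is at most 1 by [D_dual_vertex], so no term can be smaller than
    its absolute value. *)
Lemma D_dual_vertex_eq p q r a b c : D_dual e p q r -> D_vertex e a b c ->
    a * p + b * q + c * r = 1 ->
  [/\ a * p = `|a| * `|p|, b * q = `|b| * `|q| & c * r = `|c| * `|r|].
Proof.
move=> d v; have := D_dual_vertex d v; rewrite -!normrM.
by have := ler_norm (a * p); have := ler_norm (b * q); have := ler_norm (c * r); split; lra.
Qed.

(** A nonzero [p] forces [a] and [a'] to have the same sign, a nonzero [p'] forces opposite
    signs. *)
Lemma mul_norm_cross a a' p p' : a != 0 -> a' != 0 ->
    a * p = `|a| * `|p| -> a' * p = `|a'| * `|p| ->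
    a * p' = `|a| * `|p'| -> a' * - p' = `|a'| * `|p'| ->
  p = 0 \/ p' = 0.
Proof.
rewrite -!normr_gt0 => a0 a0' ap ap' app app'.
have [->|pn0] := eqVneq p 0; first by left.
have [->|p'n0] := eqVneq p' 0; first by right.
move: pn0 p'n0; rewrite -!normr_gt0 => p0 p0'.
have h1 : 0 < a * a' * p ^+ 2.
  have -> : a * a' * p ^+ 2 = (a * p) * (a' * p) by ring.
  by rewrite ap ap' !mulr_gt0.
have h2 : 0 < - (a * a') * p' ^+ 2.
  have -> : - (a * a') * p' ^+ 2 = (a * p') * (a' * - p') by ring.
  by rewrite app app' !mulr_gt0.
have P2 : 0 < p ^+ 2 by rewrite exprn_even_gt0//= -normr_gt0.
have P2' : 0 < p' ^+ 2 by rewrite exprn_even_gt0//= -normr_gt0.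
by move: h1 h2; rewrite (pmulr_lgt0 _ P2) (pmulr_lgt0 _ P2'); lra.
Qed.

Lemma D_dual_third p q r : D_dual e p q r -> e * `|r| <= e * (4 / 3).
Proof. by case=> h _ _ _; rewrite ler_pM2l//; lra. Qed.

(** Only a corner survives. At a vertex with a coordinate [1 - e] in absolute value, comparison with
    the inequality for the exchanged vertex kills the coefficient [p'] or [q]; what remains is
    [e / 2] times a third coefficient, too small to be 1. *)
Lemma D_dual_square p q r a b c p' q' r' :
    D_dual e p q r -> D_dual e p' q' r' -> D_vertex e a b c ->
    p = 0 -> q' = 0 -> `|a| != 0 ->
    `|a| * `|p| + `|b| * `|q| + `|c| * `|r| = 1 ->
    `|a| * `|p'| + `|b| * `|q'| + `|c| * `|r'| = 1 ->
  [/\ `|q| = 1, r = 0, `|p'| = 1 & r' = 0].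
Proof.
have he0 := e0; have he1 := e1.
move=> [d1 d2 d3 d4] [d1' d2' d3' d4'] v p0 q0 a0.
rewrite p0 q0 normr0 in d2 d3 d4 d2' d3' d4' *.
have er : e * `|r| <= e * (4 / 3) by rewrite ler_pM2l//; lra.
have er' : e * `|r'| <= e * (4 / 3) by rewrite ler_pM2l//; lra.
case: v => -[ha hb hc]; rewrite ha hb hc.
- by rewrite ha normr0 eqxx in a0.
- move=> _ h; have : `|p'| <= 0 by rewrite -(pmulr_rle0 _ e0); lra.
  by rewrite normr_le0 => /eqP p'0; move: h; rewrite p'0 normr0; lra.
- move=> h _; have : `|q| <= 0 by rewrite -(pmulr_rle0 _ e0); lra.
  by rewrite normr_le0 => /eqP q'0; move: h; rewrite q'0 normr0; lra.
- rewrite normr0 => h h'.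
  have : `|r| <= 0 by rewrite -(pmulr_rle0 _ e0); lra.
  have : `|r'| <= 0 by rewrite -(pmulr_rle0 _ e0); lra.
  by rewrite !normr_le0 => /eqP-> /eqP->; split=> //; lra.
Qed.

Lemma D_vertex_apex b c : D_vertex e 0 b c -> b = 0 /\ `|c| = 3 / 4.
Proof.
have he0 := e0; have he1 := e1.
by case=> -[ha hb hc] //; move: ha; rewrite normr0; lra.
Qed.

Lemma D_vertex_neq0 a b c : D_vertex e a b c -> a != 0 -> b != 0.
Proof.
have he1 := e1; move=> v a0; rewrite -normr_gt0.
by case: v => -[ha hb hc]; rewrite ?hb; [rewrite ha eqxx in a0|lra|lra|lra].
Qed.

Lemma D_vertex_third a b c r : D_vertex e a b c -> a != 0 ->
  e * `|r| <= e * (4 / 3) -> `|c| * `|r| != 1.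
Proof.
have he0 := e0; have he1 := e1; move=> v a0 er; apply/eqP.
by case: v => -[ha hb hc]; rewrite ?hc ?normr0; [rewrite ha eqxx in a0|lra|lra|lra].
Qed.

(** The values at the apex give [r = r'] with [|r| = 4/3], and the opposite sign conditions then
    force [c = 0]. So the other vertex is a corner with [|p| + |q| = 1], and the sum of the two
    middle inequalities of [D_dual] fails by [e / 3]. *)
Lemma D_dual_apex p q r r' a b c c' : D_dual e p q r -> D_vertex e a b c ->
    `|c'| = 3 / 4 -> c' * r = 1 -> c' * r' = 1 -> c * - r' = `|c| * `|r'| ->
  a * p + b * q + c * r != 1.
Proof.
have he0 := e0; have he1 := e1; move=> d v c34 cr cr' cNr'; apply/eqP => vE.
have [pa qb rc] := D_dual_vertex_eq d v vE.
have c0 : c' != 0 by rewrite -normr_gt0 c34; lra.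
have rr : r' = r by apply: (mulfI c0); rewrite cr cr'.
have r43 : `|r| = 4 / 3.
  have : `|c' * r| = 1 by rewrite cr normr1.
  by rewrite normrM c34; lra.
have cr0 : `|c| = 0 by move: cNr' rc; rewrite rr mulrN r43; lra.
case: v => -[ha hb hc]; [lra|lra|lra|].
have pq1 : `|p| + `|q| = 1 by move: vE; rewrite pa qb rc ha hb cr0; lra.
have epq : e * (`|p| + `|q|) = e * 1 by rewrite pq1.
by case: d => _ d2 d3 _; move: d2 d3; rewrite r43; clear -he0 he1 pq1 epq; lra.
Qed.

(* The plane spanned by the two vertices is isometric to the square, which
   forces both of them to be corners. *)
Lemma D_square p q r p' q' r' a b c a' b' c' :
    D_dual e p q r -> D_dual e p' q' r' ->
    D_vertex e a b c -> D_vertex e a' b' c' ->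
    a * p + b * q + c * r = 1 -> a * p' + b * q' + c * r' = 1 ->
    a' * p + b' * q + c' * r = 1 -> a' * p' + b' * q' + c' * r' = -1 ->
  [/\ `|p| = 1, q = 0, r = 0 & [/\ p' = 0, `|q'| = 1 & r' = 0]] \/
  [/\ p = 0, `|q| = 1, r = 0 & [/\ `|p'| = 1, q' = 0 & r' = 0]].
Proof.
move=> d d' v v' hv gv hv' gv'.
have dN : D_dual e (- p') (- q') (- r').
  by case: (d') => ? ? ? ?; split; rewrite !normrN.
(* Negating the second functional makes its value at the second vertex 1, so the equality analysis
   applies to all four pairs. *)
have gN : a' * - p' + b' * - q' + c' * - r' = 1 by lra.
have [s1 s2 s3] := D_dual_vertex_eq d v hv.
have [s1' s2' s3'] := D_dual_vertex_eq d' v gv.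
have [t1 t2 t3] := D_dual_vertex_eq d v' hv'.
have [t1' t2' t3'] := D_dual_vertex_eq dN v' gN.
rewrite !normrN in t1' t2' t3'.
have [a0|a0] := eqVneq a 0.
  move: v hv gv; rewrite a0 => /D_vertex_apex[-> c34]; rewrite !mul0r !add0r.
  by move=> cr cr'; case/eqP: (D_dual_apex d v' c34 cr cr' t3').
have [a'0|a'0] := eqVneq a' 0.
  move: v' hv' gN; rewrite a'0 => /D_vertex_apex[-> c34]; rewrite !mul0r !add0r.
  move=> cr cr'; have s3N : c * - - r' = `|c| * `|- r'| by rewrite opprK normrN.
  by case/eqP: (D_dual_apex d v c34 cr cr' s3N).
have er := D_dual_third d; have er' := D_dual_third d'.
have sumN : `|a| * `|p| + `|b| * `|q| + `|c| * `|r| = 1 by rewrite -s1 -s2 -s3.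
have sumN' : `|a| * `|p'| + `|b| * `|q'| + `|c| * `|r'| = 1.
  by rewrite -s1' -s2' -s3'.
have na : `|a| != 0 by rewrite normr_eq0.
(* In each of the first two coordinates one of the functionals has coefficient 0. The same
   functional cannot vanish in both, as its third term alone is less than 1. *)
have [p0|p0] := mul_norm_cross a0 a'0 s1 t1 s1' t1'; have [q0|q0] :=
    mul_norm_cross (D_vertex_neq0 v a0) (D_vertex_neq0 v' a'0) s2 t2 s2' t2'.
- by move: (D_vertex_third v a0 er) sumN; rewrite p0 q0 normr0 !mulr0 !add0r => /eqP.
- by right; have [] := D_dual_square d d' v p0 q0 na sumN sumN'.
- by left; have [] := D_dual_square d' d v p0 q0 na sumN' sumN.
- by move: (D_vertex_third v a0 er') sumN'; rewrite p0 q0 normr0 !mulr0 !add0r => /eqP.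
Qed.

End D_equality.

(** * Comparison with the maximum norm and existence of maximizers *)

Lemma lipschitz_rV_continuous {R : realType} n (phi : 'rV[R]_n -> R) (C : R) :
  (forall u v, `|phi u - phi v| <= C * `|u - v|) -> continuous phi.
Proof.
move=> h u; apply/(@cvgrPdist_lt _ _ _ _ (nbhs_filter u)) => eps eps0; near=> v.
apply: le_lt_trans (h u v) _.
have : `|u - v| < eps / (`|C| + 1).
  near: v; apply: (@cvgr_dist_lt _ _ _ _ (nbhs_filter u) id u cvg_id).
  by rewrite divr_gt0// ltr_wpDl.
rewrite ltr_pdivlMr ?ltr_wpDl// => /le_lt_trans; apply.
rewrite mulrC ler_wpM2l// (le_trans (ler_norm C))// lerDl.
Unshelve. all: by end_near. Qed.

Lemma coord_le_norm {R : realType} m n (v : 'M[R]_(m, n)) i j : `|v i j| <= `|v|.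
Proof.
by rewrite [leRHS]mx_normrE; exact: (le_bigmax _ (fun ij => `|v ij.1 ij.2|) (i, j)).
Qed.

Section D_bpb.
Context {R : realType} (e : R).
Hypotheses (e0 : 0 < e) (e1 : e < 1).
Local Notation X := (D_space e).
Implicit Types (f g : {linear X -> R^o}) (x y : X).

(** Compactness of [D_ball] is known in the topology of row vectors; this estimate transfers
    continuity to it. The constant 4 rounds up 1 + 4/3. *)
Lemma norm_D_mx (v : 'rV[R]_3) : `|v : X| <= 4 * `|v|.
Proof.
have [a [b [c vE]]] := ptE false (v : X).
have ha : `|a| <= `|v|.
  by have := coord_le_norm v 0 0; rewrite (_ : v 0 0 = a)// vE mxE.
have hb : `|b| <= `|v|.
  by have := coord_le_norm v 0 1; rewrite (_ : v 0 1 = b)// vE mxE.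
rewrite {1}vE (_ : pt e false a b c = pt e false a b 0 + pt e false 0 0 c).
  rewrite (le_trans (ler_normD _ _))//.
  have := norm_pt_square e false ha hb; have := norm_pt_axis e false c.
  have : `|c| <= `|v|.
    by have := coord_le_norm v 0 2%:R; rewrite (_ : v 0 2%:R = c)// vE mxE.
  have := normr_ge0 v; lra.
by rewrite ptD !addr0 add0r.
Qed.

Lemma D_span (v : X) : exists c : 'I_(size [:: pt e false 1 0 0; pt e false 0 1 0;
    pt e false 0 0 1]) -> R,
  v = \sum_i c i *: [:: pt e false 1 0 0; pt e false 0 1 0; pt e false 0 0 1]`_i.
Proof.
have [a [b [c ->]]] := ptE false v; exists (fun i => [:: a; b; c]`_i).
rewrite !big_ord_recl big_ord0 addr0 /= -!/(pt e false _ _ _) !ptZ !ptD.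
by rewrite !(mulr1, mulr0, addr0, add0r).
Qed.

(** The penalized functional [phi] is Lipschitz for the maximum norm, so it has a maximizer on the
    compact ball, as [ball_perturbation] requires. *)
Lemma D_perturbation f x (k : R) : 0 <= k -> `|x| <= 1 ->
  exists (y : X) (L : {linear X -> R^o}), [/\ `|y| <= 1,
    k * `|y - x| <= f y - f x,
    y = x \/ k * `|y - x| < f y - f x,
    forall v, `|L v : R| <= k * `|v| &
    forall z, `|z| <= 1 -> f z - L z <= f y - L y].
Proof.
move=> k0 x1; pose phi (z : 'rV[R]_3) : R := f (z : X) - k * `|(z : X) - x|.
have phi_cont : continuous phi.
  apply: (@lipschitz_rV_continuous _ _ _ ((dual_norm f + k) * 4)) => u v.
  have D0 : 0 <= dual_norm f.
    by apply: le_trans (dual_norm_ge f (x := 0) _); rewrite ?normr0.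
  have -> : phi u - phi v = (f (u : X) - f (v : X)) -
      k * (`|(u : X) - x| - `|(v : X) - x|) by rewrite /phi; ring.
  have h1 : `|(f (u : X) - f (v : X)) : R| <= dual_norm f * `|(u : X) - (v : X)|.
    by rewrite -linearB; exact: dual_norm_bound.
  have h2 : `| (`|(u : X) - x| - `|(v : X) - x|) : R| <= `|(u : X) - (v : X)|.
    apply: le_trans (ler_dist_dist _ _) _.
    by rewrite opprB addrA subrK.
  rewrite (le_trans (ler_normB _ _))// normrM (ger0_norm k0).
  have h3 := norm_D_mx (u - v).
  have := ler_wpM2l k0 h2; have := ler_wpM2l D0 h3; have := ler_wpM2l k0 h3.
  rewrite -[(u - v : X)]/((u : X) - (v : X)); lra.
have [|y0 yB ymax] := @EVT_max_rV R 3 phi (D_ball e) _ (@D_ball_compact R e)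
    (continuous_subspaceT phi_cont).
  exists (0 : X); have : `|0 : X| <= 1 by rewrite normr0.
  by rewrite -D_space_unit_ball.
apply: (ball_perturbation D_span k0 (y0 := (y0 : X))) => //.
  by move: yB; rewrite inE -D_space_unit_ball.
move=> z z1; apply: ymax; rewrite inE.
have : [set x : D_space e | `|x| <= 1] z by [].
by rewrite D_space_unit_ball.
Qed.

End D_bpb.

(** * The strict estimate for a single pair *)

Section D_bpb_strict.
Context {R : realType} (e : R).
Hypotheses (e0 : 0 < e) (e1 : e < 1).
Local Notation X := (D_space e).
Implicit Types (f g : {linear X -> R^o}) (x y : X).

(** [f - L] attains its norm [t] at [y], and [t] is within [k] of the norm of [f] because
    [|L| <= k]. The assumption [k < dual_norm f] makes [t] positive, so [g] can be taken as
    [(f - L) / t]. *)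
Lemma D_perturbation_norming f x (k : R) :
    0 <= k -> k < dual_norm f -> `|x| <= 1 ->
  exists y (L g : {linear X -> R^o}) (t : R), [/\ norming_pairs (y, g),
    k * `|y - x| <= f y - f x,
    y = x \/ k * `|y - x| < f y - f x,
    forall v, `|L v : R| <= k * `|v| &
    `|t - dual_norm f| <= k /\ forall v, f v = L v + t * g v].
Proof.
move=> k0 kf x1.
have [y [L [y1 ky yx Lk yL]]] := D_perturbation f k0 x1.
pose t : R := f y - L y.
have absL (v : X) : `|v| <= 1 -> `|L v : R| <= k.
  by move=> v1; rewrite (le_trans (Lk v))// ler_piMr.
have ft : dual_norm f - k <= t.
  rewrite lerBlDr; apply: dual_norm_le => v /norm_D_points v1.
  have fv (w : X) : `|w| <= 1 -> f w <= t + k.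
    by move=> w1; have := yL _ w1; have := absL _ w1; rewrite ler_norml /t; lra.
  by rewrite ler_norml fv// andbT lerNl -linearN fv// normrN.
have tf : t <= dual_norm f + k.
  have := absL _ y1; have := le_trans (ler_norm _) (dual_norm_ge f y1).
  by rewrite ler_norml /t; lra.
have t0 : 0 < t by lra.
pose g : {linear X -> R^o} := t^-1 \*: (f \- L).
have gE v : g v = t^-1 * (f v - L v) :> R by [].
exists y, L, g, t; split=> //.
  apply: norming_pairsI => //; last by rewrite gE mulVf// gt_eqF.
  apply: dual_norm_le => v /norm_D_points v1; rewrite ler_norml; apply/andP.
  have gle w : `|w| <= 1 -> g w <= 1.
    by move=> w1; rewrite gE ler_pdivrMl// mulr1; exact: yL.
  split; last exact: gle.
  by rewrite lerNl -linearN; apply: gle; rewrite normrN.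
split; first by rewrite ler_norml; lra.
by move=> v; rewrite gE mulrA divff ?gt_eqF// mul1r addrCA subrr addr0.
Qed.

(** Both summands of the lower bound [k + k] are at most [k], hence equal to [k]. The choice
    [t = 1 + k] would give [f w = 1 + 2 k]; so [t = 1 - k], and [f v = 1] is a convex combination of
    [hv] and [gv]. *)
Lemma perturbation_equality (k t hw gw hv gv : R) : 0 < k -> k < 1 ->
    `|t - 1| <= k -> hw <= 1 -> `|gw| <= 1 -> hv <= 1 -> gv <= 1 ->
    k + k <= k * hw + (t - 1) * gw -> k * hw + t * gw <= 1 ->
    k * hv + t * gv = 1 ->
  [/\ t = 1 - k, hw = 1, gw = -1, hv = 1 & gv = 1].
Proof.
move=> k0 k1 tk hw1 gw1 hv1 gv1 fgw fw fv.
have kw : k * hw <= k by rewrite ler_piMr// ltW.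
have tg : `|(t - 1) * gw| <= `|t - 1| by rewrite normrM ler_piMr.
have tg' := ler_norm ((t - 1) * gw).
have hwE : hw = 1 by apply: (mulfI (lt0r_neq0 k0)); lra.
have tgk : (t - 1) * gw = k by lra.
have tkE : `|t - 1| = k by lra.
have [tE gwE] : t = 1 - k /\ gw = -1.
  have [tk'|tk'] : t - 1 = k \/ t - 1 = - k.
  - by move: tkE; case: (ger0P (t - 1)) => _; [left|right]; lra.
  - have gwE : gw = 1 by apply: (mulfI (lt0r_neq0 k0)); rewrite -[in LHS]tk' tgk mulr1.
    by move: fw; rewrite hwE gwE; lra.
  - split; first lra.
    by apply: (mulfI (lt0r_neq0 k0)); rewrite tk' in tgk; lra.
have k1' : 0 < 1 - k by lra.
have kv : k * hv <= k by rewrite ler_piMr// ltW.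
have kv' : (1 - k) * gv <= 1 - k by rewrite ler_piMr// ltW.
rewrite tE in fv; split=> //.
  by apply: (mulfI (lt0r_neq0 k0)); lra.
by apply: (mulfI (lt0r_neq0 k1')); lra.
Qed.

Lemma D_bpb_strict f x : `|x| <= 1 -> dual_norm f <= 1 -> 1 - e ^+ 2 / 2 <= f x ->
  exists y g, [/\ norming_pairs (y, g), `|x - y| < e & dual_norm (f \- g) < e].
Proof.
have he0 := e0; have he1 := e1; have ee : e ^+ 2 < e by rewrite expr2 gtr_pMr.
move=> x1 f1 fx; have fxF : f x <= dual_norm f.
  exact: le_trans (ler_norm _) (dual_norm_ge f x1).
have gpt g v : norming_pairs (v, g) -> forall w, `|w| <= 1 -> `|g w : R| <= 1.
  by move=> [_ _ /= g1 _] w w1; rewrite -g1; exact: dual_norm_ge.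
have ee0 : 0 < e ^+ 2 by rewrite exprn_gt0.
have [s sE] : exists s, s = 1 - dual_norm f by exists (1 - dual_norm f).
have [s0|s0] := ltP 0 s.
  (* With this [k], [f y - f x <= e^2 / 2 - s < k e], and
     [|f - g| <= 2 k + s = e - s / e + s < e]. *)
  pose k := (e ^+ 2 / 2 - s / 2) / e.
  have ke : k * e = e ^+ 2 / 2 - s / 2 by rewrite /k divfK// gt_eqF.
  have k0 : 0 < k by rewrite divr_gt0//; lra.
  have ke2 : k <= e / 2.
    by rewrite ler_pdivrMr//; lra.
  have kF : k < dual_norm f by lra.
  have [y [L [g [t [yg ky _ Lk [tF fE]]]]]] := D_perturbation_norming (ltW k0) kF x1.
  exists y, g; split=> //.
    rewrite distrC -(ltr_pM2l k0) ke; apply: le_lt_trans ky _.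
    have fy : f y <= dual_norm f.
      apply: le_trans (ler_norm _) (dual_norm_ge f _).
      by case: yg => _ /= ->.
    lra.
  have [v /norm_D_points v1 ->] := dual_norm_attained (f \- g).
  rewrite /= fE (_ : L v + t * g v - g v = L v + (t - 1) * g v); last by ring.
  have Lv : `|L v : R| <= k by rewrite (le_trans (Lk v))// ler_piMr// ltW.
  have tg : `|(t - 1) * g v| <= `|t - 1|.
    by rewrite normrM ler_piMr// (gpt _ _ yg).
  have ts : `|t - 1| <= k + s.
    by move: tF; rewrite !ler_norml; lra.
  apply: (le_lt_trans (ler_normD _ _)).
  have : k + k + s < e.
    rewrite -(ltr_pM2r e0) !mulrDl ke -expr2.
    have : s * e < s by rewrite gtr_pMr.
    lra.
  lra.
have F1 : dual_norm f = 1 by lra.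
pose k := e / 2; have k0 : 0 < k by rewrite /k; lra.
have kF : k < dual_norm f by rewrite /k F1; lra.
have [y [L [g [t [yg ky yx Lk [tF fE]]]]]] := D_perturbation_norming (ltW k0) kF x1.
have xy : `|x - y| < e.
  case: yx => [->|yx]; first by rewrite subrr normr0.
  rewrite distrC -(ltr_pM2l k0); apply: (lt_le_trans yx).
  have fy : f y <= 1.
    rewrite -F1; apply: le_trans (ler_norm _) (dual_norm_ge f _).
    by case: yg => _ /= ->.
  by rewrite /k; lra.
have [fg|fg] := ltP (dual_norm (f \- g)) e; first by exists y, g.
(* From here [|f - g| >= e], the equality case; [f = k h + t g] with [h] and [g] in the dual
   ball. *)
pose h : {linear X -> R^o} := k^-1 \*: L.
have hE v : L v = k * h v :> R.
  by rewrite /= [in RHS]/GRing.scale /= mulrA divff ?gt_eqF// mul1r.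
have h1 v : `|v| <= 1 -> `|h v : R| <= 1.
  move=> v1; have := Lk v; rewrite hE normrM (gtr0_norm k0) ler_pM2l//.
  by move=> /le_trans; apply.
have fgE v : f v - g v = k * h v + (t - 1) * g v by rewrite fE hE; ring.
have sgn (q : {linear X -> R^o}) : exists v, [/\ v \in (D_points e : seq X) \/
    - v \in (D_points e : seq X) & q v = dual_norm q].
  have [v vp ->] := dual_norm_attained q.
  case: (ger0P (q v)) => _; first by exists v; split=> //; left.
  by exists (- v); rewrite opprK linearN; split=> //; right.
have vert v : v \in (D_points e : seq X) \/ - v \in (D_points e : seq X) ->
    exists a b c, v = pt e false a b c /\ D_vertex e a b c.
  move=> [/(D_points_vertex e0 e1 false)//|/(D_points_vertex e0 e1 false)].
  move=> [a [b [c [vE vv]]]]; exists (- a), (- b), (- c).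
  by rewrite -ptN -vE opprK; split=> //; exact: D_vertexN.
have vn v : v \in (D_points e : seq X) \/ - v \in (D_points e : seq X) -> `|v| <= 1.
  by move=> [/norm_D_points//|/norm_D_points]; rewrite normrN.
(* [f] attains its norm at the vertex [v], and [f - g] at the vertex [w]. *)
have [v [vp fv]] := sgn f.
have [w [wp fgw]] := sgn (f \- g : {linear X -> R^o}).
have gle u : `|u| <= 1 -> g u <= 1.
  by move=> u1; exact: le_trans (ler_norm _) (gpt _ _ yg _ u1).
have hle u : `|u| <= 1 -> h u <= 1.
  by move=> u1; exact: le_trans (ler_norm _) (h1 _ u1).
have hw := hle _ (vn _ wp); have gv := gle _ (vn _ vp); have hv := hle _ (vn _ vp).
have fw : f w <= 1.
  by rewrite -F1; exact: le_trans (ler_norm _) (dual_norm_ge f (vn _ wp)).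
have k1 : k < 1 by rewrite -F1.
have fgw' : k + k <= k * h w + (t - 1) * g w.
  by rewrite -fgE (_ : k + k = e) ?[leRHS]fgw// /k -splitr.
have fv' : k * h v + t * g v = 1 by rewrite -hE -fE fv.
have fw' : k * h w + t * g w <= 1 by rewrite -hE -fE.
rewrite F1 in tF.
have [t1 hw1 gw1 hv1 gv1] := perturbation_equality k0 k1 tF hw
  (gpt _ _ yg _ (vn _ wp)) hv gv fgw' fw' fv'.
have [p [q [r hpt]]] := pt_linear h false.
have [p' [q' [r' gpt']]] := pt_linear g false.
have fpt a b c : f (pt e false a b c) =
    k * (a * p + b * q + c * r) + (1 - k) * (a * p' + b * q' + c * r').
  by rewrite fE hE hpt gpt' t1.
have [a [b [c [vE vv]]]] := vert _ vp.
have [a' [b' [c' [wE wv]]]] := vert _ wp.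
rewrite vE hpt in hv1; rewrite vE gpt' in gv1.
rewrite wE hpt in hw1; rewrite wE gpt' in gw1.
(* The two outcomes differ by exchanging the first two coordinates, which the flag of [D_bpb_corner]
   takes into account. *)
have [] := D_square e0 e1 (D_dual_form e0 e1 hle hpt) (D_dual_form e0 e1 gle gpt')
  vv wv hv1 gv1 hw1 gw1.
- move=> [p1 q0 r0 [p0' q1' r0']].
  apply: (@D_bpb_corner _ _ e0 e1 false f x (k * p) ((1 - k) * q')) => //.
  + by move=> a1 b1 c1; rewrite fpt q0 r0 p0' r0'; ring.
  + by rewrite normrM p1 mulr1 gtr0_norm.
  + by rewrite normrM q1' mulr1 gtr0_norm// subr_gt0.
- move=> [p0 q1 r0 [p1' q0' r0']].
  apply: (@D_bpb_corner _ _ e0 e1 true f x (k * q) ((1 - k) * p')) => //.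
  + move=> a1 b1 c1; rewrite -[pt e true a1 b1 c1]/(pt e false b1 a1 c1) fpt.
    by rewrite p0 r0 q0' r0'; ring.
  + by rewrite normrM q1 mulr1 gtr0_norm.
  + by rewrite normrM p1' mulr1 gtr0_norm// subr_gt0.
Qed.

End D_bpb_strict.

(** * Uniformity by compactness *)

Section D_compactness.
Context {R : realType} (e : R).
Hypotheses (e0 : 0 < e) (e1 : e < 1).
Local Notation X := (D_space e).
Implicit Types (f g h : {linear X -> R^o}) (x y : X).

(** Functionals are encoded by their coefficients, so that compactness can be used in a product of
    two spaces of row vectors. *)
Definition row_form (w : 'rV[R]_3) : {linear X -> R^o} :=
  pt_form false (w 0 0) (w 0 1) (w 0 2%:R).

Lemma row_form_surj f : exists w, row_form w =1 f.
Proof.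
have [p [q [r fE]]] := pt_linear f false; exists (point3 p q r) => x.
by have [a [b [c ->]]] := ptE false x; rewrite fE /row_form /= pt_formE !mxE.
Qed.

Lemma row_formB (u w : 'rV[R]_3) x :
  row_form u x - row_form w x = row_form (u - w) x.
Proof. by rewrite /row_form /= /pt_form !mxE; ring. Qed.

Lemma dual_norm_row_form (w : 'rV[R]_3) : dual_norm (row_form w) <= 3 * `|w|.
Proof.
have he0 := e0; have he1 := e1.
apply: dual_norm_le => x /(D_points_vertex e0 e1 false)[a [b [c [-> v]]]].
rewrite /row_form /= pt_formE.
have le1 (t i : R) : `|t| <= 1 -> `|i| <= `|w| -> `|t * i| <= `|w|.
  by move=> t1 iw; rewrite normrM (le_trans _ iw)// ler_piMl.
have [a1 b1 c1] : [/\ `|a| <= 1, `|b| <= 1 & `|c| <= 1].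
  by case: v => -[-> -> ->]; rewrite ?normr0; split; lra.
rewrite (le_trans (ler_normD _ _))//.
have := ler_normD (a * w 0 0) (b * w 0 1).
have := le1 _ _ a1 (coord_le_norm w 0 0); have := le1 _ _ b1 (coord_le_norm w 0 1).
by have := le1 _ _ c1 (coord_le_norm w 0 2%:R); lra.
Qed.

Lemma dual_norm_leD f g h :
    (forall x, `|f x : R| <= `|g x : R| + `|h x : R|) ->
  dual_norm f <= dual_norm g + dual_norm h.
Proof.
move=> fgh; apply: dual_norm_le => x /norm_D_points x1.
by rewrite (le_trans (fgh x))// lerD// dual_norm_ge.
Qed.

Lemma dual_norm_row_formB (u w : 'rV[R]_3) :
  dual_norm (row_form u \- row_form w) <= 3 * `|u - w|.
Proof.
rewrite (_ : _ \- _ = row_form (u - w) :> (X -> R))//; last first.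
  by apply/funext => x; exact: row_formB.
exact: dual_norm_row_form.
Qed.

(** The weak inequality keeps this set closed. *)
Definition bpb_data : set ('rV[R]_3 * 'rV[R]_3) :=
  (D_ball e `*` [set w | dual_norm (row_form w) <= 1]) `&`
  [set p | 1 - e ^+ 2 / 2 <= row_form p.2 p.1].

Lemma bpb_data_compact : compact bpb_data.
Proof.
apply: compact_closedI.
  apply: compact_setX; first exact: D_ball_compact.
  apply: bounded_closed_compact.
    (* [D_dual] bounds the coefficients by 1, 1 and 4/3, well below 4. *)
    exists 4; split; first exact: num_real.
    move=> M M4 w /= w1; rewrite (le_trans _ (ltW M4))//.
    have wle x : `|x| <= 1 -> row_form w x <= 1.
      move=> x1; apply: le_trans (ler_norm _) _.
      exact: le_trans (dual_norm_ge _ x1) w1.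
    have [h1 _ _ h4] := D_dual_form e0 e1 wle
      (pt_formE e false (w 0 0) (w 0 1) (w 0 2%:R)).
    have [] : [/\ `|w 0 0| <= 4, `|w 0 1| <= 4 & `|w 0 2%:R| <= 4].
      have := normr_ge0 (w 0 0); have := normr_ge0 (w 0 1).
      by move: h1 h4 => h1 h4; split; lra.
    move=> w00 w01 w02; rewrite [leLHS]mx_normrE; apply/bigmax_leP; split=> //.
    move=> [i [[|[|[|//]]] hj]] _ /=; rewrite ord1.
    - by move: w00; congr (`|w _ _| <= 4); exact/val_inj.
    - by move: w01; congr (`|w _ _| <= 4); exact/val_inj.
    - by move: w02; congr (`|w _ _| <= 4); exact/val_inj.
  rewrite [X in closed X](_ : _ =
    (fun w => dual_norm (row_form w)) @^-1` [set x | x <= 1])//.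
  apply: preimage_closed; last exact: closed_le.
  move=> + _.
  apply: (@lipschitz_rV_continuous _ _ _ 3) => u w.
  have hD u' w' : dual_norm (row_form u') <=
      dual_norm (row_form u' \- row_form w') + dual_norm (row_form w').
    apply: dual_norm_leD => x /=.
    by rewrite (le_trans _ (ler_normD _ _))// subrK.
  have := hD u w; have := hD w u; have := dual_norm_row_formB u w.
  have := dual_norm_row_formB w u; rewrite (distrC w u) ler_norml; lra.
rewrite [X in closed X](_ : _ = (fun p : 'rV[R]_3 * 'rV[R]_3 =>
   p.1 0 0 * p.2 0 0 + p.1 0 1 * p.2 0 1 + p.1 0 2%:R * p.2 0 2%:R) @^-1`
   [set t | 1 - e ^+ 2 / 2 <= t])//.
apply: preimage_closed; last exact: closed_ge.
move=> p _.
have c1 j : (fun q : 'rV[R]_3 * 'rV[R]_3 => q.1 0 j) q @[q --> p] --> p.1 0 j.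
  by apply: (@continuous_comp _ _ _ (fun q : 'rV[R]_3 * 'rV[R]_3 => q.1) (fun v => v 0 j));
    [exact: cvg_fst|exact: coord_continuous].
have c2 j : (fun q : 'rV[R]_3 * 'rV[R]_3 => q.2 0 j) q @[q --> p] --> p.2 0 j.
  by apply: (@continuous_comp _ _ _ (fun q : 'rV[R]_3 * 'rV[R]_3 => q.2) (fun v => v 0 j));
    [exact: cvg_snd|exact: coord_continuous].
by apply: cvgD; [apply: cvgD|]; apply: cvgM.
Qed.

(** A norming pair that serves [(x, w)] with distances below [e] also serves all nearby data with
    any [e'] close enough to [e]; compactness of [bpb_data] yields one [e'] for all. *)
Lemma D_bpb_uniform : exists2 e' : R, 0 < e' < e &
  forall f x, `|x| <= 1 -> dual_norm f <= 1 -> 1 - e ^+ 2 / 2 <= f x ->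
    exists y g, [/\ norming_pairs (y, g), `|x - y| < e' & dual_norm (f \- g) < e'].
Proof.
pose P (e' : R) (p : 'rV[R]_3 * 'rV[R]_3) := exists y g, [/\ norming_pairs (y, g),
  `|(p.1 : X) - y| < e' & dual_norm (row_form p.2 \- g) < e'].
have near_e : \forall e' \near e^'-, bpb_data `<=` P e'.
  apply: (compact_near_coveringP _).1 => [|[x w] [[/= xB w1] fx]].
    exact: bpb_data_compact.
  have [|y [g [yg xy wg]]] := D_bpb_strict e0 e1 _ w1 fx.
    by move: xB; rewrite -D_space_unit_ball.
  have [d [xd wd de]] : exists d, [/\ `|(x : X) - y| <= d,
      dual_norm (row_form w \- g) <= d & d < e].
    exists (Num.max `|(x : X) - y| (dual_norm (row_form w \- g))).
    by rewrite !le_max !lexx orbT gt_max xy wg.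
  (* Moving [x] by [r] costs at most [4 r] and moving [w] at most [3 r], so both distances stay
     below [d + 4 r = (d + e) / 2]. *)
  pose r := (e - d) / 8.
  have r0 : 0 < r by rewrite /r; lra.
  exists ([set p | ball x r p.1 /\ ball w r p.2], [set e' | (d + e) / 2 < e']).
    split => /=.
      by exists (ball x r, ball w r) => //; split; exact: nbhsx_ballx.
    by apply: nbhs_left_gt; lra.
  move=> [[x' w'] e'] /= [[xx' ww'] de']; exists y, g; split=> //=.
    move: xx'; rewrite -ball_normE /ball_ /= distrC => xx'.
    have h := norm_D_mx e (x' - x).
    rewrite (_ : (x' : X) - y = ((x' : X) - x) + ((x : X) - y)).
      apply: (le_lt_trans (ler_normD _ _)).
      by move: h xx'; rewrite /r -[(x' - x : X)]/((x' : X) - (x : X)); lra.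
    by rewrite addrA subrK.
  move: ww'; rewrite -ball_normE /ball_ /= distrC => ww'.
  have h := dual_norm_row_formB w' w.
  have : dual_norm (row_form w' \- g) <=
      dual_norm (row_form w' \- row_form w) + dual_norm (row_form w \- g).
    apply: dual_norm_leD => z /=.
    by rewrite (le_trans _ (ler_normD _ _))// addrA subrK.
  by move: ww'; rewrite /r; lra.
have /filter_ex[e' [e'0 e'e Ke']] : \forall e' \near e^'-,
    [/\ 0 < e', e' < e & bpb_data `<=` P e'].
  near=> e'; split; [|by []|by near: e'].
  by near: e'; exact: nbhs_left_gt.
exists e'; first by rewrite e'0.
move=> f x x1 f1 fx; have [w wf] := row_form_surj f.
have fE : (f : X -> R^o) = row_form w by apply/funext => z; rewrite wf.
rewrite fE in f1 fx *; apply: (Ke' (x, w)); split=> //; split=> //.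
by rewrite /= -D_space_unit_ball.
Unshelve. all: by end_near. Qed.

End D_compactness.

Theorem theorem6p1 (R : realType) (delta : R)
    (delta_gt0 : 0 < delta) (delta_lt : delta < 1 / 2) :
  (bpb_modulus (D_space (Num.sqrt (2 * delta))) delta
    < (Num.sqrt (2 * delta))%:E)%E.
Proof.
set e := Num.sqrt (2 * delta).
have d0 : 0 <= 2 * delta by lra.
have e0 : 0 < e by rewrite sqrtr_gt0; lra.
have e1 : e < 1 by rewrite -(@ltr_pXn2r _ 2) ?nnegrE ?ltW// sqr_sqrtr// expr1n; lra.
have dE : delta = e ^+ 2 / 2 by rewrite sqr_sqrtr//; lra.
have [e' /andP[e'0 e'e] He'] := D_bpb_uniform e0 e1.
apply: (@le_lt_trans _ _ e'%:E); last by rewrite lte_fin.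
(* [e'] is itself admissible in the infimum, as [delta = e^2 / 2]. *)
apply: ereal_inf_lbound; exists e' => //; split=> // x f _ x1 f1 fx.
by apply: He' => //; rewrite -dE ltW.
Qed.
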